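(* If a separable Fréchet space contains isomorphic copies of all separable Montel spaces, then it must also contain isomorphic copies of $c_0$ and of $\ell_p$ for all $p\in[1,\infty)$.
   Context: A Fréchet space is a completely metrizable locally convex topological vector space (real scalars) whose topology can be defined by an invariant metric. A subset $K$ of a Fréchet space is bounded if for every neighborhood $U$ of $0$ there is $a\in\mathbb{R}$ with $K\subseteq aU$. Here a Montel space means a Fréchet space all of whose closed bounded subsets are compact. A Fréchet space $X$ contains an isomorphic copy of $Y$ if some closed subspace of $X$ is linearly homeomorphic to $Y$. *)

(* Defs.v *)
From HB Require Import structures.
From mathcomp Require Import all_boot all_order all_algebra.
From mathcomp Require Import all_classical all_reals all_analysis.

Set Implicit Arguments.
Unset Strict Implicit.
Unset Printing Implicit Defensive.

Import Order.TTheory GRing.Theory Num.Theory.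
Import numFieldNormedType.Exports.

Local Open Scope classical_set_scope.
Local Open Scope ring_scope.

Section metrizability.
Context {R : realType}.

Definition is_metric (T : Type) (d : T -> T -> R) :=
  [/\ forall x, d x x = 0,
      forall x y, d x y = 0 -> x = y,
      forall x y, d x y = d y x &
      forall x y z, d x z <= d x y + d y z].

Definition induces_topology (T : topologicalType) (d : T -> T -> R) :=
  forall x : T,
    nbhs x = filter_from [set e : R | 0 < e] (fun e => [set y | d x y < e]).

(* As d will always induce the topology of T, the limit of a d-Cauchy sequence
   can be taken in T. *)
Definition complete_metric (T : topologicalType) (d : T -> T -> R) :=
  forall u : nat -> T,
    (forall e : R, 0 < e -> exists N : nat, forall m n : nat,
      (N <= m)%N -> (N <= n)%N -> d (u m) (u n) < e) ->
    exists l : T, u @ \oo --> l.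

End metrizability.

Definition separable (T : topologicalType) :=
  exists2 A : set T, countable A & dense A.

(* A [tvsType] is locally convex, but neither Hausdorff nor metrizable in
   general, and its uniform structure is only required to induce the topology
   (it need not be translation invariant). Completeness is therefore expressed
   with a metric, and the uniform structure is never used. *)
Section frechet.
Context {R : realType}.
Implicit Types X Y : tvsType R.

Definition completely_metrizable X := exists d : X -> X -> R,
  [/\ is_metric d, induces_topology d & complete_metric d].

Definition invariantly_metrizable X := exists d : X -> X -> R,
  [/\ is_metric d, induces_topology d &
      forall x y z : X, d (x + z) (y + z) = d x y].

Definition frechet X := completely_metrizable X /\ invariantly_metrizable X.

(* [bounded_set] from the library is about norms. *)
Definition tvs_bounded X (K : set X) :=
  forall U : set X, nbhs 0 U -> exists a : R, K `<=` [set a *: u | u in U].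

Definition montel X := frechet X /\
  forall K : set X, closed K -> tvs_bounded K -> compact K.

Definition closed_subspace X (S : set X) :=
  closed S /\ submod_closed [pred x | x \in S].

Definition linearly_homeomorphic Y X (S : set X) :=
  exists (f : {linear Y -> X}) (g : X -> Y),
    [/\ range f = S, cancel f g, continuous f & {within S, continuous g}].

Definition contains_copy X Y :=
  exists2 S : set X, closed_subspace S & linearly_homeomorphic Y S.

End frechet.

Section c0.
Context (R : realType).

Definition c0_pred : {pred nat -> R} :=
  mem [set x : nat -> R | x n @[n --> \oo] --> (0 : R)].

Lemma c0_submod_closed : submod_closed c0_pred.
Proof.
split; first by rewrite inE; exact: cvg_cst.
move=> a x y; rewrite !inE /= => x0 y0.
rewrite -[X in _ --> X](addr0 (0 : R)) -[X in _ --> X + _](mulr0 a).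
by apply: cvgD => //; apply: cvgM => //; exact: cvg_cst.
Qed.

HB.instance Definition _ := GRing.isSubmodClosed.Build _ _ c0_pred
  c0_submod_closed.

Record c0 := C0 { c0_val :> nat -> R ; _ : c0_val \in c0_pred }.

HB.instance Definition _ := [isSub for c0_val].
HB.instance Definition _ := [Choice of c0 by <:].
HB.instance Definition _ := [SubChoice_isSubLmodule of c0 by <:].

Definition c0_norm (x : c0) : R := sup (range (fun n => `|x n|)).

Let c0_has_sup (x : c0) : has_sup (range (fun n => `|x n|)).
Proof.
split; first by exists `|x 0%N|, 0%N.
have /set_mem /= x0 := valP x.
have /cvg_seq_bounded[M [_ Mx]] : cvgn (x : nat -> R) by apply/cvg_ex; exists 0.
by exists (M + 1) => _ [n _ <-]; apply: Mx => //; rewrite ltrDl.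
Qed.

Let c0_norm_ge (x : c0) n : `|x n| <= c0_norm x.
Proof. by apply: ub_le_sup; [exact: (c0_has_sup x).2|exists n]. Qed.

Let c0_norm_le (x : c0) M : (forall n, `|x n| <= M) -> c0_norm x <= M.
Proof.
by move=> xM; apply: ge_sup; [exact: (c0_has_sup x).1|move=> _ [n _ <-]].
Qed.

Let ler_c0_normD x y : c0_norm (x + y) <= c0_norm x + c0_norm y.
Proof. by apply: c0_norm_le => n; rewrite (le_trans (ler_normD _ _))// lerD. Qed.

Let c0_normZ_le (a : R) x : c0_norm (a *: x) <= `|a| * c0_norm x.
Proof.
by apply: c0_norm_le => n; rewrite [X in `|X|]/= normrM ler_wpM2l.
Qed.

Let c0_norm_eq0 x : c0_norm x = 0 -> x = 0.
Proof.
move=> x0; apply/val_inj/funext => n; apply/eqP.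
by rewrite -normr_le0 -x0 c0_norm_ge.
Qed.

Let c0_normZ (a : R) x : c0_norm (a *: x) = `|a| * c0_norm x.
Proof.
apply/eqP; rewrite eq_le c0_normZ_le/=.
have [->|a0] := eqVneq a 0.
  by rewrite normr0 mul0r (le_trans _ (c0_norm_ge _ 0%N)).
rewrite -ler_pdivlMl ?normr_gt0// -normfV.
by rewrite -{1}(scalerK a0 x) c0_normZ_le.
Qed.

HB.instance Definition _ :=
  Lmodule_isNormed.Build R c0 ler_c0_normD c0_normZ c0_norm_eq0.

End c0.

(* The p-integrable functions on nat for the counting measure (every function
   on nat is measurable), with the library's p-norm: it is the usual norm of
   l_p by [ellp_normE]. No quotient is needed since the empty set is the only
   null set. *)
Section ellp.
Context (R : realType) (p : R) (p1 : 1 <= p).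

Local Notation mu := (counting : {measure set nat -> \bar R}).

Lemma ellp_lee1 : (1 <= p%:E)%E. Proof. by rewrite lee_fin. Qed.

Definition ellp : Type := LfunType mu ellp_lee1.

HB.instance Definition _ := GRing.Lmodule.on ellp.

Definition ellp_fun (x : ellp) : nat -> R := x.

Definition ellp_norm (x : ellp) : R := fine ('N[mu]_p%:E[EFin \o ellp_fun x])%E.

Lemma ellp_normE (x : ellp) : ((ellp_norm x)%:E =
  (\sum_(0 <= k <oo) (`|ellp_fun x k| `^ p)%:E) `^ p^-1)%E.
Proof.
by rewrite /ellp_norm finite_norm_fine Lnorm_counting// (lt_le_trans ltr01).
Qed.

Let ler_ellp_normD (x y : ellp) :
  ellp_norm (x + y) <= ellp_norm x + ellp_norm y.
Proof. exact: ler_LnormD. Qed.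

Let ellp_normZ (a : R) (x : ellp) : ellp_norm (a *: x) = `|a| * ellp_norm x.
Proof.
by apply/EFin_inj; rewrite EFinM !finite_norm_fine; exact: LnormZ.
Qed.

Let ellp_norm_eq0 (x : ellp) : ellp_norm x = 0 -> x = 0.
Proof.
move=> x0.
have pow_ge0 k : (0 <= k)%N -> xpredT k -> (0 <= (`|ellp_fun x k| `^ p)%:E)%E.
  by rewrite lee_fin powR_ge0.
have sum0 : (\sum_(0 <= k <oo) (`|ellp_fun x k| `^ p)%:E = 0)%E.
  by apply: (@poweR_eq0_eq0 _ _ p^-1); [exact: nneseries_ge0|rewrite -ellp_normE x0].
apply/LfuneqP => k; apply/normr0_eq0/(@powR_eq0_eq0 _ _ p)/eqP.
rewrite eq_le powR_ge0 andbT -lee_fin.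
apply: (@le_trans _ _ (\sum_(0 <= j <oo) (`|ellp_fun x j| `^ p)%:E)%E).
  apply: le_trans (nneseries_lim_ge k.+1 pow_ge0).
  by rewrite big_nat_recr//= leeDr// sume_ge0.
by rewrite sum0.
Qed.

HB.instance Definition _ :=
  Lmodule_isNormed.Build R ellp ler_ellp_normD ellp_normZ ellp_norm_eq0.

End ellp.

(* Main.v *)
From HB Require Import structures.
Require Import Defs.
From mathcomp Require Import all_boot all_order all_algebra.
From mathcomp Require Import all_classical all_reals all_analysis.
From mathcomp Require Import zify ring lra.

(** Let B be c_0 or l_p.  Call a sequence of vectors of X a B-basis if a finite
    combination of them is small as soon as its coefficients have a small
    B-norm, and conversely.  The closed span of a B-basis is a copy of B
    ([contains_copy_basis]), so such a sequence has to be found in X.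

    The finite attempts at a B-basis are organised in a tree over a countable
    alphabet, [basis_tree]: the entries of a node give approximations to the
    vectors chosen so far, by members of a fixed dense sequence of X, and the
    constants that occur in the required estimates.  Along an infinite branch
    the approximated vectors converge to a B-basis ([basis_tree_copy]).

    Suppose now that the tree has no infinite branch.  Consider the Koethe
    space Y of functions y on the nodes for which, for each k, the B-norms of
    the finite subfamilies of (2^(k g_k(t)) y(t))_t are bounded, where g_k(t)
    is the sum of the codes of the letters of t that are visible at level k.
    On an infinite set of nodes with pairwise comparable weights, Koenig's
    lemma would exhibit an infinite branch: hence there is no such set
    ([tree_matrix_montel]), and that makes Y a separable Montel space
    ([kothe_montel], [kothe_separable]).  On the other hand, past the letters
    visible at level k, the weight of level k does not change along a branch,
    so that the unit vectors of Y on the prefixes of a node behave like the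
    first unit vectors of B ([branch_part_le]), with constants that depend
    only on the visible letters.

    By hypothesis Y embeds in X.  If t is a node of length n, the images
    of the unit vectors on the n + 1 prefixes of t are n + 1 vectors of X which
    form an attempt one step longer than t, and so t extends to a node of
    length n + 1.  Iterating from the root gives an infinite branch, a
    contradiction ([embedding_ill_founded]).  This diagonal argument replaces
    the comparison of the ordinal ranks of two trees.

    One point needs care.  The constant of the m-th estimate has to be written
    in the m-th letter, before the next letters are known, although it involves
    the weights up to a level K(m) which depends on the unknown embedding.  For
    this reason a letter also carries a delay: the letter that follows it is
    invisible below that level.  Choosing the delays large enough hides
    from the levels below K(m) all that comes from position m on.

    Finally, a Frechet space is given with a complete metric and with an
    invariant metric, which may differ; that the second one is complete as well
    is a theorem of Klee ([klee_complete]). *)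

Set Implicit Arguments.
Unset Strict Implicit.
Unset Printing Implicit Defensive.

Import Order.TTheory GRing.Theory Num.Theory.
Import numFieldNormedType.Exports.

Local Open Scope classical_set_scope.
Local Open Scope ring_scope.

(** * Elementary limits *)

Section limits.
Context {R : realType}.

Lemma eventually_in_seq (I : eqType) (F : seq I) (P : I -> nat -> Prop) :
  (forall t, t \in F -> exists N, forall n, (N <= n)%N -> P t n) ->
  exists N, forall n, (N <= n)%N -> forall t, t \in F -> P t n.
Proof.
elim: F => [|u F IH] H; first by exists 0%N.
have [N HN] := H u (mem_head _ _).
have [M HM] := IH (fun t tF => H t (mem_behead (s := u :: F) tF)).
exists (maxn N M) => n; rewrite geq_max => /andP[Nn Mn] t.
by rewrite inE => /predU1P[->|tF]; [exact: HN|exact: HM].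
Qed.

Lemma real_cauchy_cvg (u : nat -> R) :
  (forall e, 0 < e -> exists N : nat, forall m n : nat,
    (N <= m)%N -> (N <= n)%N -> `|u m - u n| <= e) ->
  exists l, forall e, 0 < e -> exists N : nat, forall n, (N <= n)%N -> `|l - u n| <= e.
Proof.
move=> cu; have : cvg (u @ \oo).
  apply/cauchy_cvgP/cauchy_exP => e e0; have e2 : 0 < e / 2 by lra.
  have [N HN] := cu _ e2; exists (u N); exists N => // n /= Nn.
  by rewrite /ball /=; have := HN _ _ (leqnn N) Nn; lra.
move=> /cvgrPdist_le ul; exists (lim (u @ \oo)) => e /ul [N _ HN].
by exists N.
Qed.

Lemma archimedean_inv_lt (e : R) : 0 < e ->
  exists N : nat, forall n, (N <= n)%N -> n.+1%:R^-1 < e.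
Proof.
move=> e0; exists (Num.trunc e^-1) => n Nn.
rewrite invf_plt ?posrE//.
by apply: lt_le_trans (truncnS_gt _) _; rewrite ler_nat ltnS.
Qed.

Lemma half_expr_lt (e : R) (i : nat) : 0 < e ->
  exists2 l, (i <= l)%N & 2^-1 ^+ l < e.
Proof.
move=> e0; have [N HN] := archimedean_inv_lt e0; exists (maxn i N); first exact: leq_maxl.
apply: le_lt_trans (HN (maxn i N) (leq_maxr _ _)).
by rewrite exprVn lef_pV2 ?posrE ?exprn_gt0// -natrX ler_nat ltn_expl.
Qed.

End limits.

(** * Complete F-norms and Klee's theorem *)

Section complete_fnorm.
Context {R : realType}.
Implicit Types X : tvsType R.

Definition fnorm_cauchy X (phi : X -> R) (u : nat -> X) :=
  forall e : R, 0 < e -> exists N : nat, forall m n : nat,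
    (N <= m)%N -> (N <= n)%N -> phi (u m - u n) < e.

Definition fnorm_cvg X (phi : X -> R) (u : nat -> X) (l : X) :=
  forall e : R, 0 < e -> exists N : nat, forall n : nat,
    (N <= n)%N -> phi (u n - l) < e.

(** The distance to 0 for an invariant complete metric.  The estimates on a basis
    only speak of neighbourhoods of 0, for which one F-norm is more convenient
    than a family of seminorms. *)
Record complete_fnorm X (phi : X -> R) : Prop := CompleteFnorm {
  fnorm0 : phi 0 = 0 ;
  fnorm_eq0 : forall x, phi x = 0 -> x = 0 ;
  fnormN : forall x, phi (- x) = phi x ;
  ler_fnormD : forall x y, phi (x + y) <= phi x + phi y ;
  fnorm_nbhsP : forall (x : X) (U : set X), nbhs x U <->
    exists2 e : R, 0 < e & forall y, phi (y - x) < e -> U y ;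
  fnorm_complete : forall u, fnorm_cauchy phi u -> exists l, fnorm_cvg phi u l
}.

Lemma induces_topology_cvgP (T : topologicalType) (d : T -> T -> R)
    (u : nat -> T) (l : T) : is_metric d -> induces_topology d ->
  (u @ \oo --> l) <-> forall e : R, 0 < e -> exists N : nat, forall n : nat,
    (N <= n)%N -> d l (u n) < e.
Proof.
move=> md hd; split=> [ul e e0|ul A].
  have /ul [N _ uN] : nbhs l [set y | d l y < e].
    by rewrite hd; exists e.
  by exists N => n Nn; apply: uN.
rewrite /= hd => -[e /= e0 eA]; have [N uN] := ul e e0.
by exists N => // n /= Nn; apply: eA; exact: uN.
Qed.

(** In the completion of X for d, the limit of u is a sum of two elements of X,
    because X and its translates are residual there.  Directly: choose indices
    n_k and put S_k = u(n_k) - S_(k-1), so that u(n_k) = S_k + S_(k-1) and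
    S_(k+2) - S_k = u(n_(k+2)) - u(n_(k+1)).  When n_(k+1) is chosen,
    S_k is known, and the tail of u past n_(k+1) can be required to be so
    small for d that S_(k+2) is 2^-k-close to S_k for the complete metric d'.
    Then both the even and the odd S_k converge. *)
Lemma klee_complete X (d : X -> X -> R) (u : nat -> X) :
  completely_metrizable X -> is_metric d -> induces_topology d ->
  (forall x y z : X, d (x + z) (y + z) = d x y) ->
  (forall e : R, 0 < e -> exists N : nat, forall m n : nat,
      (N <= m)%N -> (N <= n)%N -> d (u m) (u n) < e) ->
  exists l : X, u @ \oo --> l.
Proof.
move=> [d' [md' hd' cd']] md hd dinv cu.
(* From the index [N e] on, u oscillates by less than e. *)
have step (e : R) : exists N : nat, 0 < e -> forall m n : nat,
    (N <= m)%N -> (N <= n)%N -> d (u m) (u n) < e.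
  by have [/cu[N HN]|] := pselect (0 < e); [exists N|exists 0%N].
have [N HN] := choice step.
(* [delta (x, k)] is a d-radius that forces 2^-k-closeness for d'. *)
have close (x : X * nat) : exists e : R, 0 < e /\
    forall y, d x.1 y < e -> d' x.1 y < 2^-1 ^+ x.2.
  have : nbhs x.1 [set y | d' x.1 y < 2^-1 ^+ x.2].
    by rewrite hd'; exists (2^-1 ^+ x.2) => //=; rewrite exprn_gt0.
  by rewrite hd => -[e /= e0 H]; exists e.
have [delta Hd] := choice close.
pose next k (sn : X * nat) :=
  let n' := maxn sn.2.+1 (N (delta (sn.1, k))) in (u n' - sn.1, n').
pose st := fix st k := if k is k'.+1 then next k' (st k') else (u 0%N, 0%N).
pose S k := (st k).1; pose n_ k := (st k).2.
have nS k : n_ k.+1 = maxn (n_ k).+1 (N (delta (S k, k))) by [].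
have SS k : S k.+1 = u (n_ k.+1) - S k by [].
have SSD k : d' (S k) (S k.+2) < 2^-1 ^+ k.
  apply: (Hd (S k, k)).2 => /=.
  have d0 := (Hd (S k, k)).1.
  have Sk : S k = u (n_ k.+1) + - (S k.+1) by rewrite SS opprB addrC subrK.
  rewrite {1}Sk (SS k.+1) dinv; apply: (HN _ d0).
    by rewrite nS; lia.
  by rewrite (nS k.+1) nS; lia.
have cS (i : nat) : exists l : X, (fun k => S (i + k.*2)%N) @ \oo --> l.
  apply: (cd' (fun k => S (i + k.*2)%N)) => e e0.
  have half0 : 0 <= 2^-1 :> R by lra.
  have half1 : 2^-1 <= 1 :> R by lra.
  have tail k m : d' (S (i + k.*2)%N) (S (i + (k + m).*2)%N) <= 2 * (2^-1 ^+ k).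
    (* The exact geometric sum is the bound that goes through the induction. *)
    have : d' (S (i + k.*2)%N) (S (i + (k + m).*2)%N) <=
       2 * (2^-1 ^+ k) - 2 * (2^-1 ^+ (k + m)).
      elim: m => [|m IH].
        by rewrite addn0 subrr; case: md' => ->.
      case: md' => _ _ _ dt; apply: (le_trans (dt _ (S (i + (k + m).*2)%N) _)).
      have := SSD (i + (k + m).*2)%N.
      rewrite addnS doubleS !addnS => /ltW h1.
      have h2 : 2^-1 ^+ (i + (k + m).*2) <= 2^-1 ^+ (k + m) :> R.
        by apply: ler_wiXn2l => //; lia.
      have h3 : 2^-1 ^+ (k + m).+1 = 2^-1 * 2^-1 ^+ (k + m) :> R by rewrite exprS.
      rewrite h3; lra.
    have : 0 < 2^-1 ^+ (k + m) :> R by rewrite exprn_gt0.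
    lra.
  have e4 : 0 < e / 4 by lra.
  have [K _ HK] := half_expr_lt 0 e4.
  exists K => m n Km Kn.
  case: (md') => _ _ ds dt.
  apply: (le_lt_trans (dt _ (S (i + K.*2)%N) _)).
  have := tail K (m - K)%N; have := tail K (n - K)%N.
  rewrite !subnKC// (ds (S (i + m.*2)%N)); lra.
have [a Ha] := cS 0%N; have [b Hb] := cS 1%N.
have dD w x y z : d (w + x) (y + z) <= d w y + d x z.
  case: (md) => _ _ _ dt; apply: (le_trans (dt _ (y + x) _)).
  by rewrite dinv lerD2l (addrC y) (addrC y) dinv.
exists (a + b); apply/(induces_topology_cvgP _ _ md hd) => e e0.
have e2 : 0 < e / 3 by lra.
have [M HM] := cu _ e2.
have [Ka HKa] := (induces_topology_cvgP _ _ md hd).1 Ha _ e2.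
have [Kb HKb] := (induces_topology_cvgP _ _ md hd).1 Hb _ e2.
exists M => n Mn.
have n_ge k : (k <= n_ k)%N.
  by elim: k => [//|k IH]; rewrite nS leq_max ltnS IH.
pose k := maxn (maxn Ka Kb) M.
have Mk : (M <= n_ k.*2.+1)%N by apply: leq_trans (n_ge _); rewrite /k; lia.
case: (md) => _ _ _ dt; apply: (le_lt_trans (dt _ (u (n_ k.*2.+1)) _)).
have : d (a + b) (u (n_ k.*2.+1)) <= d a (S (0 + k.*2)%N) + d b (S (1 + k.*2)%N).
  have -> : u (n_ k.*2.+1) = S (0 + k.*2)%N + S (1 + k.*2)%N.
    by rewrite add0n add1n SS addrC subrK.
  exact: dD.
have := HKa k; have := HKb k; have := HM _ _ Mk Mn; rewrite /k.
move=> h1 /(_ ltac:(lia)) h2 /(_ ltac:(lia)) h3 h4; lra.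
Qed.

Lemma frechet_complete_fnorm X : frechet X -> exists phi : X -> R, complete_fnorm phi.
Proof.
move=> [cX [d [md hd dinv]]].
have dE x y : d x y = d 0 (y - x) by rewrite -(dinv x y (- x)) subrr.
case: (md) => d0 dsep ds dt.
exists (d 0); split => //.
- by move=> x /dsep.
- by move=> x; rewrite -[RHS](dinv _ _ (- x)) add0r subrr ds.
- move=> x y; apply: (le_trans (dt _ x _)).
  by rewrite lerD2l dE addrC addrA addNr add0r.
- move=> x U; rewrite hd; split=> -[e e0 eU]; exists e => //= y.
    by rewrite -dE => /eU.
  by rewrite /= dE => /eU.
- move=> u cu.
  have [|l /(induces_topology_cvgP _ _ md hd) ul] := klee_complete (u := u) cX md hd dinv.
    by move=> e /cu[N HN]; exists N => m n Nm Nn; rewrite dE; exact: HN.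
  by exists l => e /ul[N HN]; exists N => n Nn; rewrite -dE; exact: HN.
Qed.

End complete_fnorm.

Section fnorm_theory.
Context {R : realType} (X : tvsType R) (phi : X -> R) (Phi : complete_fnorm phi).

Lemma fnorm_ge0 x : 0 <= phi x.
Proof.
have := ler_fnormD Phi x (- x); rewrite subrr (fnorm0 Phi) (fnormN Phi); lra.
Qed.

Lemma fnorm_distC x y : phi (x - y) = phi (y - x).
Proof. by rewrite -(fnormN Phi) opprB. Qed.

Lemma ler_fnorm_dist z x y : phi (x - y) <= phi (x - z) + phi (z - y).
Proof. by rewrite (le_trans _ (ler_fnormD Phi _ _))// addrA subrK. Qed.

Lemma fnorm_scale_cvg0 (c : R) (e : R) : 0 < e ->
  exists2 d : R, 0 < d & forall x, phi x < d -> phi (c *: x) < e.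
Proof.
move=> e0; have : nbhs (c *: 0 : X) [set y | phi y < e].
  by rewrite scaler0; apply/(fnorm_nbhsP Phi); exists e => // y; rewrite subr0.
move=> /(@scale_continuous R X (c, 0))[/= [B1 B2] [/= B1c B20] BU].
have [d d0 dB] := (fnorm_nbhsP Phi 0 B2).1 B20.
exists d => // x xd; apply: (BU (c, x)); split; first exact: nbhs_singleton.
by apply: dB; rewrite subr0.
Qed.

Lemma fnorm_small0 x : (forall e, 0 < e -> phi x < e) -> x = 0.
Proof.
move=> xe; apply: (fnorm_eq0 Phi); apply/eqP; rewrite eq_le fnorm_ge0 andbT.
by apply/ler_addgt0Pr => e /xe/ltW; rewrite add0r.
Qed.

Lemma fnorm_cvg_unique u x y : fnorm_cvg phi u x -> fnorm_cvg phi u y -> x = y.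
Proof.
move=> ux uy; apply/eqP; rewrite -subr_eq0; apply/eqP/fnorm_small0 => e e0.
have e2 : 0 < e / 2 by lra.
have [N HN] := ux _ e2; have [M HM] := uy _ e2.
apply: (le_lt_trans (ler_fnorm_dist (u (maxn N M)) _ _)).
rewrite fnorm_distC; have := HN _ (leq_maxl N M); have := HM _ (leq_maxr N M).
lra.
Qed.

Lemma fnorm_cvgD u v x y : fnorm_cvg phi u x -> fnorm_cvg phi v y ->
  fnorm_cvg phi (fun n => u n + v n) (x + y).
Proof.
move=> ux vy e e0; have e2 : 0 < e / 2 by lra.
have [N HN] := ux _ e2; have [M HM] := vy _ e2; exists (maxn N M) => n NMn.
rewrite opprD addrACA (le_lt_trans (ler_fnormD Phi _ _))//.
have := HN n; have := HM n; rewrite (leq_trans (leq_maxl _ _) NMn).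
rewrite (leq_trans (leq_maxr _ _) NMn) => /(_ isT) h /(_ isT) h'; lra.
Qed.

Lemma fnorm_cvgZ c u x : fnorm_cvg phi u x ->
  fnorm_cvg phi (fun n => c *: u n) (c *: x).
Proof.
move=> ux e /(fnorm_scale_cvg0 c)[d /ux[N HN] dc]; exists N => n /HN.
by rewrite -scalerBr; exact: dc.
Qed.

Lemma fnorm_cvg_le u x M : fnorm_cvg phi u x ->
  (exists N, forall n, (N <= n)%N -> phi (u n) <= M) -> phi x <= M.
Proof.
move=> ux [N uM]; apply/ler_addgt0Pr => e /ux[N' HN'].
have := HN' _ (leq_maxr N N'); have := uM _ (leq_maxl N N').
have := ler_fnormD Phi (u (maxn N N')) (x - u (maxn N N')).
rewrite (addrC _ (x - _)) subrK fnorm_distC; lra.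
Qed.

Lemma fnorm_cvg_lt u x M : fnorm_cvg phi u x -> phi x < M ->
  exists N, forall n, (N <= n)%N -> phi (u n) < M.
Proof.
move=> ux xM; have e0 : 0 < M - phi x by lra.
have [N HN] := ux _ e0; exists N => n /HN h.
have := ler_fnormD Phi (u n - x) x; rewrite subrK; lra.
Qed.

End fnorm_theory.

(** * Symmetric norms on finite families *)

Section symnorm.
Context (R : realType).

(** What c_0 and l_p have in common: a norm of finitely supported families which
    is solid and depends neither on the order nor on the indices of the entries.
    As it acts on lists of values, the same norm serves for families
    indexed by the integers, in B, and by the nodes of a tree, in the Koethe
    space. *)
Record symnorm := SymNorm {
  symnorm_fun :> seq R -> R ;
  symnorm_triangle : forall s : seq (R * R),
    symnorm_fun [seq p.1 + p.2 | p <- s] <=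
    symnorm_fun [seq p.1 | p <- s] + symnorm_fun [seq p.2 | p <- s] ;
  symnormZ : forall c s, symnorm_fun [seq c * x | x <- s] = `|c| * symnorm_fun s ;
  symnorm_solid : forall s : seq (R * R), all (fun p => `|p.1| <= `|p.2|) s ->
    symnorm_fun [seq p.1 | p <- s] <= symnorm_fun [seq p.2 | p <- s] ;
  symnorm_perm : forall s t, perm_eq s t -> symnorm_fun s = symnorm_fun t ;
  symnorm_subseq : forall s t, subseq s t -> symnorm_fun s <= symnorm_fun t ;
  symnorm_filter_neq0 : forall s,
    symnorm_fun [seq x <- s | x != 0] = symnorm_fun s ;
  symnorm1 : forall x, symnorm_fun [:: x] = `|x|
}.

End symnorm.

Section symnorm_theory.
Context {R : realType} (rho : symnorm R).

Lemma symnorm_nil : rho [::] = 0.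
Proof. by have := symnormZ rho 0 [::]; rewrite normr0 mul0r. Qed.

Lemma symnorm_ge0 s : 0 <= rho s.
Proof. by rewrite -symnorm_nil symnorm_subseq// sub0seq. Qed.

Lemma symnorm_mapD (I : Type) (F : seq I) (x y : I -> R) :
  rho [seq x t + y t | t <- F] <= rho (map x F) + rho (map y F).
Proof.
have := symnorm_triangle rho [seq (x t, y t) | t <- F].
by rewrite -!map_comp.
Qed.

Lemma symnorm_mapZ (I : Type) (F : seq I) (c : R) (x : I -> R) :
  rho [seq c * x t | t <- F] = `|c| * rho (map x F).
Proof. by rewrite -symnormZ -map_comp. Qed.

Lemma symnorm_map_le (I : eqType) (F : seq I) (x y : I -> R) :
  {in F, forall t, `|x t| <= `|y t|} -> rho (map x F) <= rho (map y F).
Proof.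
move=> xy; have := symnorm_solid rho (s := [seq (x t, y t) | t <- F]).
rewrite -!map_comp; apply; apply/allP => _ /mapP[t tF ->] /=; exact: xy.
Qed.

Lemma symnorm_map_filter (I : eqType) (P : pred I) (F : seq I) (x : I -> R) :
  {in F, forall t, ~~ P t -> x t = 0} -> rho (map x [seq t <- F | P t]) = rho (map x F).
Proof.
move=> x0; rewrite -[LHS]symnorm_filter_neq0 -[RHS]symnorm_filter_neq0.
congr (rho _); elim: F x0 => //= t F IH x0.
have {}IH := IH (fun u uF => x0 u (mem_behead (s := t :: F) uF)).
have [Pt|nPt] /= := boolP (P t); first by rewrite IH.
by rewrite IH (x0 t (mem_head _ _) nPt) eqxx.
Qed.

Lemma symnorm_map_subset (I : eqType) (F G : seq I) (x : I -> R) :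
  uniq F -> {subset F <= G} -> rho (map x F) <= rho (map x G).
Proof.
move=> uF FG.
have /count_subseqP[F' F'G FF'] : forall t, (count_mem t F <= count_mem t G)%N.
  move=> t; rewrite (count_uniq_mem _ uF); case: (boolP (t \in F)) => [tF|//].
  by rewrite -has_count has_pred1 FG.
rewrite (symnorm_perm rho (perm_map x FF')).
by apply: symnorm_subseq; exact: map_subseq.
Qed.

Lemma symnorm_le_sum (I : Type) (F : seq I) (x : I -> R) :
  rho (map x F) <= \sum_(t <- F) `|x t|.
Proof.
elim: F => [|t F IH]; first by rewrite big_nil symnorm_nil.
rewrite big_cons; apply: le_trans (lerD (lexx _) IH).
have := symnorm_triangle rho ((x t, 0) :: [seq (0, x u) | u <- F]).
rewrite /= -!map_comp addr0 (eq_map (_ : _ =1 x)); last by move=> u /=; rewrite add0r.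
move=> /le_trans; apply; apply: lerD.
  rewrite -[leLHS]symnorm_filter_neq0 /= filter_map [seq.filter _ F](_ : _ = [::])/=.
    by case: ifPn => _; rewrite ?(symnorm1 rho)// symnorm_nil.
  by rewrite (eq_filter (_ : _ =1 pred0)) ?filter_pred0// => u /=; rewrite eqxx.
rewrite -[leLHS]symnorm_filter_neq0 /= eqxx symnorm_filter_neq0.
by rewrite [leLHS](_ : _ = rho (map x F)).
Qed.

Lemma symnorm_mem_le (I : eqType) (F : seq I) (x : I -> R) t :
  t \in F -> `|x t| <= rho (map x F).
Proof.
move=> tF; rewrite -(symnorm1 rho) -[[:: x t]]/(map x [:: t]).
by apply: symnorm_map_subset => // u; rewrite inE => /eqP->.
Qed.

(** Lower semicontinuity for pointwise convergence: on a finite family the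
    norm is dominated by the sum of the absolute values. *)
Lemma symnorm_fatou (I : eqType) (F : seq I) (x : I -> R) (M : R) :
  (forall e : R, 0 < e -> exists2 w : I -> R, {in F, forall t, `|x t - w t| <= e} &
    rho (map w F) <= M) -> rho (map x F) <= M.
Proof.
move=> H; apply/ler_addgt0Pr => e e0.
have e1 : 0 < e / (size F).+1%:R by rewrite divr_gt0.
have [w xw wM] := H _ e1.
have -> : map x F = [seq w t + (x t - w t) | t <- F].
  by apply: eq_map => t; rewrite addrC subrK.
rewrite (le_trans (symnorm_mapD _ _ _))// lerD//.
rewrite (le_trans (symnorm_le_sum _ _))//.
apply: (@le_trans _ _ (\sum_(t <- F) (e / (size F).+1%:R))).
  by rewrite big_seq [leRHS]big_seq ler_sum.
rewrite big_const_seq count_predT iter_addr_0 -[_ *+ _]mulr_natr.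
rewrite mulrAC ler_pdivrMr// ler_pM2l// ler_nat//.
Qed.

End symnorm_theory.

Section symnorm_limits.
Context {R : realType}.

Lemma symnorm_lim (rho : symnorm R) (I : eqType) (z : nat -> I -> R)
    (y : I -> R) (F : seq I) (M : R) :
  (forall t e, 0 < e -> exists N, forall n, (N <= n)%N -> `|y t - z n t| <= e) ->
  (exists N, forall n, (N <= n)%N -> rho (map (z n) F) <= M) ->
  rho (map y F) <= M.
Proof.
move=> zy [N zM]; apply: symnorm_fatou => e e0.
have [t _|K HK] := @eventually_in_seq _ F (fun t n => `|y t - z n t| <= e).
  exact: zy.
exists (z (maxn N K)); last by rewrite zM// leq_maxl.
by move=> t tF; apply: HK => //; exact: leq_maxr.
Qed.

End symnorm_limits.

(** * Copies of a space with a symmetric basis *)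

Section coordinates.
Context {R : realType} (rho : symnorm R).

(** For l_p this is p-summability and for c_0 convergence to 0: it describes the
    closure of the finitely supported sequences rather than all the sequences of
    bounded norm, which for the supremum norm would be l_infinity. *)
Definition cauchy_tails (y : nat -> R) := forall e : R, 0 < e ->
  exists N, forall n, rho (map y (iota N n)) <= e.

Record coordinates (B : normedModType R) (co : B -> nat -> R) : Prop :=
    Coordinates {
  coordinatesP : forall a x y i, co (a *: x + y) i = a * co x i + co y i ;
  coordinates_le : forall x n, rho (map (co x) (iota 0 n)) <= `|x| ;
  coordinates_ge : forall x M, (forall n, rho (map (co x) (iota 0 n)) <= M) ->
    `|x| <= M ;
  coordinates_tails : forall x, cauchy_tails (co x) ;
  coordinates_ex : forall y, cauchy_tails y -> exists x, co x =1 y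
}.

Context (B : normedModType R) (co : B -> nat -> R) (Co : coordinates co).

Lemma coordinatesB x y i : co (x - y) i = co x i - co y i.
Proof.
by rewrite addrC -scaleN1r (coordinatesP Co) mulN1r addrC.
Qed.

Lemma coordinates_mem_le x i : `|co x i| <= `|x|.
Proof.
apply: le_trans (coordinates_le Co x i.+1).
by apply: symnorm_mem_le; rewrite mem_iota add0n leqnn.
Qed.

(** A Cauchy sequence converges coordinatewise, and the semicontinuity of the
    symmetric norm turns the coordinatewise limit into a limit in norm. *)
Lemma coordinates_complete (x : nat -> B) :
  (forall e, 0 < e -> exists N : nat, forall m n : nat,
    (N <= m)%N -> (N <= n)%N -> `|x m - x n| <= e) ->
  exists l, forall e, 0 < e -> exists N : nat, forall n, (N <= n)%N -> `|l - x n| <= e.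
Proof.
move=> cx; have coord i : exists l, forall e, 0 < e -> exists N : nat,
    forall n, (N <= n)%N -> `|l - co (x n) i| <= e.
  apply: real_cauchy_cvg => e /cx[N HN]; exists N => m n Nm Nn.
  by rewrite -coordinatesB (le_trans (coordinates_mem_le _ _))// HN.
have [y Hy] := choice coord.
have near_y e : 0 < e -> exists N, forall n, (N <= n)%N -> forall F,
    uniq F -> rho [seq y i - co (x n) i | i <- F] <= e.
  move=> /cx[N HN]; exists N => n Nn F uF.
  apply: (@symnorm_lim _ _ _ (fun m i => co (x m) i - co (x n) i)).
    move=> t d /(Hy t)[K HK]; exists K => m /HK.
    by rewrite opprB addrA subrK.
  exists N => m Nm; apply: le_trans (HN m n Nm Nn).
  apply: le_trans (coordinates_le Co _ (\max_(i <- F) i).+1).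
  rewrite (eq_map (_ : _ =1 co (x m - x n))); last first.
    by move=> i; rewrite coordinatesB.
  apply: symnorm_map_subset => // i iF.
  by rewrite mem_iota /= add0n ltnS leq_bigmax_seq.
have [l lE] : exists l, co l =1 y.
  apply: (coordinates_ex Co) => e e0; have e2 : 0 < e / 2 by lra.
  have [K /(_ K (leqnn K)) HK] := near_y _ e2.
  have [N HN] := coordinates_tails Co (x K) e2.
  exists N => n.
  rewrite (eq_map (_ : _ =1 fun i => (y i - co (x K) i) + co (x K) i)); last first.
    by move=> i; rewrite subrK.
  rewrite (le_trans (symnorm_mapD _ _ _ _))//.
  by have := HN n; have := HK _ (iota_uniq N n); lra.
exists l => e /near_y[N HN]; exists N => n Nn; apply: (coordinates_ge Co) => m.
rewrite (eq_map (_ : _ =1 fun i => y i - co (x n) i)); last first.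
  by move=> i; rewrite coordinatesB lE.
exact: HN (iota_uniq _ _).
Qed.

Context (X : tvsType R) (phi : X -> R) (Phi : complete_fnorm phi).

Definition combination (v : nat -> X) (a : nat -> R) n :=
  \sum_(0 <= i < n) a i *: v i.

(** The first hypothesis makes the series of the x_i v_i converge for every x in B,
    and its sum depend continuously on x; the second one, by homogeneity of
    the norm of B, makes the inverse continuous and the range closed. *)
Lemma contains_copy_basis (v : nat -> X) :
  (forall e, 0 < e -> exists2 d : R, 0 < d & forall a n,
    rho (map a (iota 0 n)) <= d -> phi (combination v a n) <= e) ->
  (exists2 r : R, 0 < r & forall a n,
    phi (combination v a n) < r -> rho (map a (iota 0 n)) <= 1) ->
  contains_copy X B.
Proof.
move=> upper [r r0 lower].
have pcauchy x : fnorm_cauchy phi (combination v (co x)).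
  move=> e e0; have e2 : 0 < e / 2 by lra.
  have [d d0 Hd] := upper _ e2; have [N HN] := coordinates_tails Co x d0.
  have tail m n : (N <= n)%N -> (n <= m)%N ->
      phi (combination v (co x) m - combination v (co x) n) < e.
    move=> Nn nm.
    pose a i := if (n <= i)%N then co x i else 0.
    suff -> : combination v (co x) m - combination v (co x) n = combination v a m.
      rewrite (le_lt_trans (Hd _ _ _))//; last by lra.
      rewrite -(@symnorm_map_filter _ rho _ (fun i => n <= i)%N); last first.
        by move=> i _ /negbTE; rewrite /a => ->.
      apply: le_trans (HN m).
      rewrite (_ : map a _ = map (co x) [seq i <- iota 0 m | (n <= i)%N]); last first.
        by apply/eq_in_map => i; rewrite mem_filter /a => /andP[->].
      apply: symnorm_map_subset; first by rewrite filter_uniq ?iota_uniq.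
      by move=> i; rewrite mem_filter !mem_iota => /andP[ni]; lia.
    rewrite /combination (big_cat_nat (leq0n n) nm)/= addrAC subrr add0r.
    rewrite (big_cat_nat (leq0n n) nm)/= [X in _ = X + _]big1_seq ?add0r; last first.
      move=> i /andP[_]; rewrite mem_index_iota => /andP[_ ni].
      by rewrite /a leqNgt ni scale0r.
    apply: eq_big_seq => i; rewrite mem_index_iota => /andP[ni _].
    by rewrite /a ni.
  exists N => m n Nm Nn; have [nm|mn] := leqP n m; first exact: tail.
  by rewrite (fnorm_distC Phi) tail// ltnW.
have [u Hu] := choice (fun x => fnorm_complete Phi (pcauchy x)).
have u_lin : linear u.
  move=> a x y; apply: (fnorm_cvg_unique Phi (Hu _)).
  suff -> : combination v (co (a *: x + y)) =
      (fun n => a *: combination v (co x) n + combination v (co y) n).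
    by apply: (fnorm_cvgD Phi) => //; exact: fnorm_cvgZ.
  apply/funext => n; rewrite /combination scaler_sumr -big_split/=.
  by apply: eq_bigr => i _; rewrite (coordinatesP Co) scalerDl scalerA.
pose f : {linear B -> X} := HB.pack u (GRing.isLinear.Build R B X *:%R u u_lin).
have f_upper e : 0 < e -> exists2 d, 0 < d & forall x, `|x| <= d -> phi (f x) <= e.
  move=> /upper[d d0 Hd]; exists d => // x xd.
  apply: (fnorm_cvg_le Phi (Hu x)); exists 0%N => n _; apply: Hd.
  exact: le_trans (coordinates_le Co x n) xd.
have f_lower1 x : phi (f x) < r -> `|x| <= 1.
  move=> /(fnorm_cvg_lt Phi (Hu x))[N HN]; apply: (coordinates_ge Co) => n.
  apply: le_trans (lower _ _ (HN _ (leq_maxl N n))).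
  apply: symnorm_map_subset; first exact: iota_uniq.
  by move=> i; rewrite !mem_iota /= !add0n => /leq_trans; apply; exact: leq_maxr.
have f_lower e : 0 < e -> exists2 d, 0 < d & forall x, phi (f x) < d -> `|x| <= e.
  move=> e0; have [d d0 Hd] := fnorm_scale_cvg0 Phi e^-1 r0.
  exists d => // x /Hd; rewrite -linearZ/= => /f_lower1.
  by rewrite normrZ gtr0_norm ?invr_gt0// ler_pdivrMl// mulr1.
have f_inj : injective f.
  move=> x y fxy; apply/eqP; rewrite -subr_eq0 -normr_le0.
  apply/ler_addgt0Pr => e /f_lower[d d0 Hd]; rewrite add0r; apply: Hd.
  by rewrite linearB fxy subrr (fnorm0 Phi).
have [g Hg] : exists g : X -> B, forall z, range f z -> f (g z) = z.
  have : forall z, exists x, range f z -> f x = z.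
    move=> z; have [[x _ <-]|nz] := pselect (range f z); first by exists x.
    by exists 0.
  by move=> /choice[g Hg]; exists g.
have fK : cancel f g by move=> x; apply: f_inj; rewrite Hg//; exists x.
exists (range f); last first.
  exists f, g; split => //.
    move=> x U /(fnorm_nbhsP Phi (f x) U).1[e e0 eU].
    have e2 : 0 < e / 2 by lra.
    have [d d0 Hd] := f_upper _ e2.
    apply/nbhs_ballP; exists d => //= y; rewrite -ball_normE /= distrC => /ltW xy.
    apply: eU; rewrite (_ : _ - _ = f (y - x)); last by rewrite linearB.
    by rewrite (le_lt_trans (Hd _ xy))//; lra.
  rewrite continuous_subspace_in => z /set_mem[x _ <-] U.
  rewrite /from_subspace/= fK => /nbhs_ballP[e /= e0 eU].
  have e2 : 0 < e / 2 by lra.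
  have [d d0 Hd] := f_lower _ e2.
  suff : nbhs (f x) [set z | range f z -> U (g z)].
    move=> H; rewrite /nbhs/= /nbhs/= -nbhs_subspace_in; first exact: H.
    by exists x.
  apply/(fnorm_nbhsP Phi); exists d => // _ /[swap] -[y _ <-] zd; rewrite /= fK.
  apply: eU; rewrite -ball_normE /= distrC.
  by rewrite (le_lt_trans (Hd _ _))//; [rewrite linearB|lra].
split.
  move=> z Sz.
  have approx k : exists x, phi (f x - z) < k.+1%:R^-1.
    have : nbhs z [set y | phi (y - z) < k.+1%:R^-1].
      by apply/(fnorm_nbhsP Phi); exists k.+1%:R^-1 => //; rewrite invr_gt0.
    by move=> /Sz[_ [[x _ <-]]]; exists x.
  have [x Hx] := choice approx.
  have xz : fnorm_cvg phi (f \o x) z.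
    move=> e e0; have [N HN] := archimedean_inv_lt e0.
    exists N => n Nn; apply: lt_trans (Hx n) _.
    exact: HN.
  have [l Hl] : exists l, forall e, 0 < e -> exists N, forall n, (N <= n)%N -> `|l - x n| <= e.
    apply: coordinates_complete => e /f_lower[d d0 Hd].
    have d2 : 0 < d / 2 by lra.
    have [N HN] := xz _ d2; exists N => m n Nm Nn; apply: Hd.
    rewrite linearB/= (le_lt_trans (ler_fnorm_dist Phi z _ _))//.
    rewrite (fnorm_distC Phi z).
    by have := HN _ Nm; have := HN _ Nn => /=; lra.
  exists l => //; apply: (fnorm_cvg_unique Phi (u := f \o x)) => //.
  move=> e e0; have e2 : 0 < e / 2 by lra.
  have [d d0 Hd] := f_upper _ e2; have [N HN] := Hl _ d0; exists N => n Nn /=.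
  rewrite (_ : _ - _ = f (x n - l)); last by rewrite linearB.
  by rewrite (le_lt_trans (Hd _ _))//; [rewrite distrC HN|lra].
split; first by rewrite inE; exists 0 => //; rewrite linear0.
move=> a _ _ /set_mem[x _ <-] /set_mem[y _ <-]; rewrite inE.
by exists (a *: x + y) => //; rewrite linearP.
Qed.

End coordinates.

(** * The spaces c_0 and l_p *)

Section c0_coordinates.
Context (R : realType).

Definition seq_max_norm (s : seq R) : R := \big[Num.max/0]_(x <- s) `|x|.

Lemma seq_max_norm_le s M : 0 <= M -> (forall x, x \in s -> `|x| <= M) -> seq_max_norm s <= M.
Proof.
move=> M0; rewrite /seq_max_norm; elim: s => [|x s IH] sM; first by rewrite big_nil.
rewrite big_cons ge_max sM ?mem_head//= IH// => y ys.
by apply: sM; rewrite in_cons ys orbT.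
Qed.

Lemma seq_max_norm_ge s x : x \in s -> `|x| <= seq_max_norm s.
Proof. by move=> xs; exact: (@le_bigmax_seq _ _ _ _ 0 x xpredT (fun x => `|x|)%R xs isT). Qed.

Lemma seq_max_norm_ge0 s : 0 <= seq_max_norm s.
Proof. exact: bigmax_ge_id. Qed.

Lemma seq_max_norm_triangle (s : seq (R * R)) : seq_max_norm [seq p.1 + p.2 | p <- s] <=
  seq_max_norm [seq p.1 | p <- s] + seq_max_norm [seq p.2 | p <- s].
Proof.
apply: seq_max_norm_le => [|_ /mapP[p ps ->]]; first by rewrite addr_ge0// seq_max_norm_ge0.
by rewrite (le_trans (ler_normD _ _))// lerD// seq_max_norm_ge//; exact: map_f.
Qed.

Lemma seq_max_normZ c s : seq_max_norm [seq c * x | x <- s] = `|c| * seq_max_norm s.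
Proof.
rewrite /seq_max_norm big_map; elim: s => [|x s IH].
  by rewrite !big_nil mulr0.
by rewrite !big_cons IH normrM maxr_pMr.
Qed.

Lemma seq_max_norm_solid (s : seq (R * R)) : all (fun p => `|p.1| <= `|p.2|) s ->
  seq_max_norm [seq p.1 | p <- s] <= seq_max_norm [seq p.2 | p <- s].
Proof.
move=> /allP sle; apply: seq_max_norm_le => [|_ /mapP[p ps ->]]; first exact: seq_max_norm_ge0.
by rewrite (le_trans (sle _ ps))// seq_max_norm_ge//; exact: map_f.
Qed.

Lemma seq_max_norm_subset s t : {subset s <= t} -> seq_max_norm s <= seq_max_norm t.
Proof.
move=> st; apply: seq_max_norm_le => [|x xs]; first exact: seq_max_norm_ge0.
by apply: seq_max_norm_ge; exact: st.
Qed.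

Lemma seq_max_norm_perm s t : perm_eq s t -> seq_max_norm s = seq_max_norm t.
Proof. exact: perm_big. Qed.

Lemma seq_max_norm_filter s : seq_max_norm [seq x <- s | x != 0] = seq_max_norm s.
Proof.
apply/eqP; rewrite eq_le seq_max_norm_subset/=; last by move=> x; rewrite mem_filter => /andP[].
apply: seq_max_norm_le => [|x xs]; first exact: seq_max_norm_ge0.
have [->|x0] := eqVneq x 0; first by rewrite normr0 seq_max_norm_ge0.
by apply: seq_max_norm_ge; rewrite mem_filter x0.
Qed.

Lemma seq_max_norm1 x : seq_max_norm [:: x] = `|x|.
Proof. by rewrite /seq_max_norm big_cons big_nil; apply/max_idPl. Qed.

Definition max_symnorm := SymNorm seq_max_norm_triangle seq_max_normZ seq_max_norm_solid
  seq_max_norm_perm (fun s t st => seq_max_norm_subset (mem_subseq st))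
  seq_max_norm_filter seq_max_norm1.

Lemma c0_norm_sup (x : c0 R) : has_sup (range (fun n => `|x n|)).
Proof.
split; first by exists `|x 0%N|, 0%N.
have /set_mem /= x0 := valP x.
have /cvg_seq_bounded[M [_ Mx]] : cvgn (x : nat -> R) by apply/cvg_ex; exists 0.
by exists (M + 1) => _ [n _ <-]; apply: Mx => //; rewrite ltrDl.
Qed.

Lemma c0_coordinates : coordinates max_symnorm (@c0_val R).
Proof.
split=> //.
- move=> x n; apply: seq_max_norm_le => [|_ /mapP[i _ ->]]; first exact: normr_ge0.
  by apply: ub_le_sup; [exact: (c0_norm_sup x).2|exists i].
- move=> x M xM; apply: ge_sup; first exact: (c0_norm_sup x).1.
  move=> _ [i _ <-]; apply: le_trans (xM i.+1).
  by apply: seq_max_norm_ge; apply: map_f; rewrite mem_iota add0n leqnn.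
- move=> x e e0; have /set_mem /= /cvgrPdist_le /(_ e e0)[N _ HN] := valP x.
  exists N => n; apply: seq_max_norm_le => [|_ /mapP[i + ->]]; first exact: ltW.
  rewrite mem_iota => /andP[Ni _].
  by have := HN i Ni; rewrite sub0r normrN.
- move=> y ty.
  have yP : y \in @c0_pred R.
    apply/mem_set => /=; apply/cvgrPdist_le => e /ty[N HN].
    exists N => // n /= Nn; rewrite sub0r normrN; apply: le_trans (HN (n - N).+1).
    by apply: seq_max_norm_ge; apply: map_f; rewrite mem_iota; lia.
  by exists (C0 yP).
Qed.

End c0_coordinates.

Section ellp_coordinates.
Context (R : realType) (p : R) (p1 : 1 <= p).

Let p0 : 0 < p. Proof. by rewrite (lt_le_trans ltr01). Qed.

Definition seq_lp_norm (s : seq R) : R := (\sum_(x <- s) `|x| `^ p) `^ p^-1.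

Lemma lp_sum_ge0 (s : seq R) : 0 <= \sum_(x <- s) `|x| `^ p.
Proof. by apply: sumr_ge0 => x _; exact: powR_ge0. Qed.

Lemma powR_invK (a : R) : 0 <= a -> (a `^ p) `^ p^-1 = a.
Proof. by move=> a0; rewrite -powRrM mulfV ?gt_eqF// powRr1. Qed.

Lemma powR_inv_K (a : R) : 0 <= a -> (a `^ p^-1) `^ p = a.
Proof. by move=> a0; rewrite powRAC powR_invK. Qed.

Lemma seq_lp_norm_leP s M : 0 <= M -> seq_lp_norm s <= M <-> \sum_(x <- s) `|x| `^ p <= M `^ p.
Proof.
move=> M0; split=> h.
  rewrite -(powR_inv_K (lp_sum_ge0 s)).
  by apply: ge0_ler_powR; rewrite ?nnegrE ?powR_ge0// ltW.
rewrite -(powR_invK M0).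
by apply: ge0_ler_powR; rewrite ?nnegrE ?powR_ge0 ?invr_ge0 ?lp_sum_ge0// ltW.
Qed.

Lemma lp_sumE s : \sum_(x <- s) `|x| `^ p = seq_lp_norm s `^ p.
Proof. by rewrite powR_inv_K// lp_sum_ge0. Qed.

(** A list is a function on the integers that is eventually 0; in this way
    Minkowski's inequality for the counting measure applies to lists. *)
Lemma seq_lp_norm_Lnorm (s : seq R) :
  (seq_lp_norm s)%:E = 'N[counting]_p%:E[EFin \o (fun k => nth 0%R s k)]%E.
Proof.
rewrite Lnorm_counting// (nneseries_split 0 (size s)); last first.
  by move=> k _; rewrite lee_fin powR_ge0.
rewrite add0n ereal_series_cond eseries0 ?adde0; last first.
  move=> k _ /andP[sk _].
  have E : `|nth 0 s k| `^ p = 0 by rewrite nth_default// normr0 powR0// gt_eqF.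
  exact: (congr1 EFin E).
rewrite /= sumEFin poweR_EFin; congr ((_)%:E `^ _)%E.
by rewrite (big_nth 0).
Qed.

Lemma seq_lp_norm_triangle (s : seq (R * R)) : seq_lp_norm [seq q.1 + q.2 | q <- s] <=
  seq_lp_norm [seq q.1 | q <- s] + seq_lp_norm [seq q.2 | q <- s].
Proof.
rewrite -lee_fin EFinD !seq_lp_norm_Lnorm.
have := @minkowski_EFin _ _ R counting (fun k => nth 0 [seq q.1 | q <- s] k)
  (fun k => nth 0 [seq q.2 | q <- s] k) p.
move=> /(_ ltac:(by []) ltac:(by []) p1); apply: le_trans; rewrite le_eqVlt; apply/orP; left.
apply/eqP; congr (Lnorm _ _ _); apply/funext => k /=; congr EFin.
have [ks|ks] := ltnP k (size s); last by rewrite !nth_default ?size_map// addr0.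
by rewrite !(nth_map 0).
Qed.

Lemma seq_lp_normZ c s : seq_lp_norm [seq c * x | x <- s] = `|c| * seq_lp_norm s.
Proof.
rewrite /seq_lp_norm big_map; under eq_bigr do rewrite normrM powRM//.
by rewrite -mulr_sumr powRM ?powR_ge0 ?lp_sum_ge0// powR_invK.
Qed.

Lemma seq_lp_norm_solid (s : seq (R * R)) : all (fun q => `|q.1| <= `|q.2|) s ->
  seq_lp_norm [seq q.1 | q <- s] <= seq_lp_norm [seq q.2 | q <- s].
Proof.
move=> /allP sle; apply/seq_lp_norm_leP; first exact: powR_ge0.
rewrite -lp_sumE !big_map big_seq [leRHS]big_seq ler_sum// => q /sle h.
by apply: ge0_ler_powR; rewrite ?nnegrE// ltW.
Qed.

Lemma seq_lp_norm_perm s t : perm_eq s t -> seq_lp_norm s = seq_lp_norm t.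
Proof. by move=> st; rewrite /seq_lp_norm (perm_big _ st). Qed.

Lemma seq_lp_norm_subseq s t : subseq s t -> seq_lp_norm s <= seq_lp_norm t.
Proof.
move=> st; apply/seq_lp_norm_leP; first exact: powR_ge0.
rewrite -lp_sumE; elim: t s st => [|y t IH] [|x s]//=; rewrite ?big_nil ?lp_sum_ge0//.
case: eqP => [->|_] st; first by rewrite !big_cons lerD2l IH.
by rewrite [leRHS]big_cons (le_trans (IH _ st))// lerDr powR_ge0.
Qed.

Lemma seq_lp_norm_filter s : seq_lp_norm [seq x <- s | x != 0] = seq_lp_norm s.
Proof.
rewrite /seq_lp_norm big_filter big_mkcond/=; congr (_ `^ _); apply: eq_bigr => x _.
by case: eqVneq => // ->; rewrite normr0 powR0// gt_eqF.
Qed.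

Lemma seq_lp_norm1 x : seq_lp_norm [:: x] = `|x|.
Proof. by rewrite /seq_lp_norm big_seq1 powR_invK. Qed.

Definition lp_symnorm := SymNorm seq_lp_norm_triangle seq_lp_normZ seq_lp_norm_solid
  seq_lp_norm_perm seq_lp_norm_subseq seq_lp_norm_filter seq_lp_norm1.

Lemma ellp_series (x : ellp p1) :
  (\sum_(0 <= k <oo) (`|ellp_fun x k| `^ p)%:E = (`|x| `^ p)%:E)%E.
Proof.
have := ellp_normE x; rewrite -[ellp_norm x]/`|x|.
have : (0 <= \sum_(0 <= k <oo) (`|ellp_fun x k| `^ p)%:E)%E.
  by apply: nneseries_ge0 => k _ _; rewrite lee_fin powR_ge0.
case: (\sum_(_ <= _ <oo) _)%E => [r| |] //; last first.
  by rewrite poweRyr// invr_eq0 gt_eqF.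
by rewrite lee_fin => r0 [->]; rewrite powR_inv_K.
Qed.

Lemma lp_partial_sum (y : nat -> R) m n :
  (\sum_(m <= k < m + n) (`|y k| `^ p)%:E = (seq_lp_norm (map y (iota m n)) `^ p)%:E)%E.
Proof. by rewrite sumEFin -lp_sumE big_map /index_iota addKn. Qed.

Lemma ellp_coordinates : coordinates lp_symnorm (@ellp_fun R p p1).
Proof.
have pow_ge0 (y : nat -> R) k : (0 <= (`|y k| `^ p)%:E)%E.
  by rewrite lee_fin powR_ge0.
split=> //.
- move=> x n; apply/seq_lp_norm_leP => //.
  rewrite lp_sumE -lee_fin -lp_partial_sum -ellp_series add0n.
  exact: nneseries_lim_ge.
- move=> x M xM; have M0 : 0 <= M by rewrite (le_trans _ (xM 0%N))// powR_ge0.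
  rewrite -(powR_invK (normr_ge0 x)) -(powR_invK M0).
  apply: ge0_ler_powR; rewrite ?nnegrE ?powR_ge0 ?invr_ge0 ?(ltW p0)//.
  rewrite -lee_fin -ellp_series; apply: lime_le; first exact: is_cvg_nneseries.
  apply: nearW => n; have := lp_partial_sum (ellp_fun x) 0 n; rewrite add0n => ->.
  by rewrite lee_fin; apply: ge0_ler_powR; rewrite ?nnegrE ?powR_ge0 ?(ltW p0)//; exact: xM.
- move=> x e e0.
  pose S n := \sum_(t <- map (ellp_fun x) (iota 0 n)) `|t| `^ p.
  have ep : 0 < e `^ p by exact: powR_gt0.
  (* If no partial sum came that close to the p-th power of the norm, neither
     would the whole series. *)
  have [N HN] : exists N, `|x| `^ p - e `^ p < S N.
    apply: contrapT => /forallNP nS.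
    suff : `|x| `^ p <= `|x| `^ p - e `^ p by lra.
    rewrite -lee_fin -ellp_series; apply: lime_le; first exact: is_cvg_nneseries.
    apply: nearW => n; have := lp_partial_sum (ellp_fun x) 0 n; rewrite add0n => ->.
    by rewrite lee_fin -lp_sumE leNgt; apply/negP; exact: nS.
  exists N => n; apply/seq_lp_norm_leP; first exact: ltW.
  have : S (N + n)%N <= `|x| `^ p.
    rewrite /S lp_sumE -lee_fin -lp_partial_sum -ellp_series add0n.
    exact: nneseries_lim_ge.
  rewrite /S iotaD map_cat big_cat/= -/(S N) add0n; lra.
- move=> y ty; have [N HN] := ty _ ltr01.
  have yLfun : y \in Lfun counting p%:E.
    apply/andP; split; rewrite inE//=.
    rewrite /finite_norm Lnorm_counting// poweR_lty//.
    rewrite -/(\sum_(0 <= k <oo) (`|y k| `^ p)%:E < +oo)%E.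
    rewrite (nneseries_split 0 N)//; last by move=> k _; exact: pow_ge0.
    rewrite add0n; apply: (@le_lt_trans _ _ (\sum_(0 <= k < N) (`|y k| `^ p)%:E + 1)%E).
      rewrite leeD2l//; apply: lime_le.
        by apply: is_cvg_nneseries => k _ _; exact: pow_ge0.
      apply: nearW => n; have [nN|/ltnW Nn] := leqP n N; first by rewrite big_geq.
      rewrite -(subnKC Nn) lp_partial_sum lee_fin [leRHS](_ : 1 = 1 `^ p); last by rewrite powR1.
      by apply: ge0_ler_powR; rewrite ?nnegrE ?powR_ge0 ?(ltW p0)//; exact: HN.
    by rewrite sumEFin -EFinD ltry.
  by exists (Lfun_Sub (ellp_lee1 p1) yLfun).
Qed.

End ellp_coordinates.

(** * Koethe spaces *)

Record kothe_matrix (R : realType) (I : Type) := KotheMatrix {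
  kothe_weight :> nat -> I -> R ;
  kothe_weight_gt0 : forall k t, 0 < kothe_weight k t
}.

Section kothe_space.
Context (R : realType) (I : countType) (rho : symnorm R) (a : kothe_matrix R I).

Definition kothe_part k (F : seq I) (x : I -> R) : R :=
  rho [seq a k t * x t | t <- F].

Lemma kothe_partD k F x y :
  kothe_part k F (x + y) <= kothe_part k F x + kothe_part k F y.
Proof.
apply: le_trans (symnorm_mapD _ _ _ _).
by rewrite /kothe_part; under eq_map => t do rewrite mulrDr.
Qed.

Lemma kothe_partZ k F c x : kothe_part k F (c *: x) = `|c| * kothe_part k F x.
Proof.
rewrite -symnorm_mapZ /kothe_part.
by under [in RHS]eq_map => t do rewrite mulrCA.
Qed.

Lemma kothe_part_ge0 k F x : 0 <= kothe_part k F x.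
Proof. exact: symnorm_ge0. Qed.

Lemma kothe_part0 k F : kothe_part k F 0 = 0.
Proof. by rewrite -(scale0r 0) kothe_partZ normr0 mul0r. Qed.

Lemma kothe_partN k F x : kothe_part k F (- x) = kothe_part k F x.
Proof. by rewrite -scaleN1r kothe_partZ normrN1 mul1r. Qed.

Definition kothe_pred : {pred I -> R} := mem [set x : I -> R |
  forall k, exists M, forall F, uniq F -> kothe_part k F x <= M].

Lemma kothe_submod_closed : submod_closed kothe_pred.
Proof.
split; first by rewrite inE => k; exists 0 => F _; rewrite kothe_part0.
move=> c x y; rewrite !inE /= => xk yk k.
have [M HM] := xk k; have [N HN] := yk k; exists (`|c| * M + N) => F uF.
rewrite (le_trans (kothe_partD _ _ _ _))// lerD ?HN//.
by rewrite kothe_partZ ler_wpM2l// HM.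
Qed.

HB.instance Definition _ := GRing.isSubmodClosed.Build _ _ kothe_pred
  kothe_submod_closed.

Record kothe := Kothe { kothe_val :> I -> R ; _ : kothe_val \in kothe_pred }.

HB.instance Definition _ := [isSub for kothe_val].
HB.instance Definition _ := [Choice of kothe by <:].
HB.instance Definition _ := [SubChoice_isSubLmodule of kothe by <:].

Lemma kotheP (x : kothe) k : exists M, forall F, uniq F -> kothe_part k F x <= M.
Proof. by have /set_mem := valP x; apply. Qed.

Lemma kothe_valD (x y : kothe) : kothe_val (x + y) = kothe_val x + kothe_val y.
Proof. by []. Qed.

Lemma kothe_valZ c (x : kothe) : kothe_val (c *: x) = c *: kothe_val x.
Proof. by []. Qed.

Lemma kothe_ext (x y : kothe) : kothe_val x =1 kothe_val y -> x = y.
Proof. by move=> xy; apply/val_inj/funext. Qed.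

Definition kothe_min (x : kothe) (kF : nat * seq I) : R :=
  Num.min kF.1.+1%:R^-1 (kothe_part kF.1 (undup kF.2) x).

(** With p_k the seminorm of weight k (the supremum of [kothe_part] over all
    finite sets), this is sup_k min(1/(k+1), p_k(x)).  Taking the supremum over
    k and the finite sets at once makes it bounded by 1, hence meaningful
    independently of the finiteness of the p_k.  The lists are made duplicate-free by
    [undup] so that all of them can be allowed as indices. *)
Definition kothe_fnorm (x : kothe) : R := sup (range (kothe_min x)).

Lemma kothe_min_has_sup x : has_sup (range (kothe_min x)).
Proof.
split; first by exists (kothe_min x (0, [::])%N), (0, [::])%N.
exists 1 => _ [[k F] _ <-]; rewrite ge_min invf_le1// ler1n//.
Qed.

Lemma kothe_fnorm_leP x e : kothe_fnorm x <= e <->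
  forall k F, uniq F -> (k.+1%:R^-1 <= e) || (kothe_part k F x <= e).
Proof.
split=> [xe k F uF|xe].
  rewrite -ge_min; apply: le_trans xe; apply: ub_le_sup.
    exact: (kothe_min_has_sup x).2.
  by exists (k, F) => //; rewrite /kothe_min undup_id.
apply: ge_sup; first exact: (kothe_min_has_sup x).1.
by move=> _ [[k F] _ <-]; rewrite ge_min; apply: xe; exact: undup_uniq.
Qed.

Lemma kothe_fnorm_ge0 x : 0 <= kothe_fnorm x.
Proof.
have /kothe_fnorm_leP/(_ 0%N [::] isT) := lexx (kothe_fnorm x).
rewrite invr1 /kothe_part /= symnorm_nil => /orP[|//].
exact: le_trans.
Qed.

Lemma kothe_fnorm_part x k F : uniq F -> kothe_fnorm x < k.+1%:R^-1 ->
  kothe_part k F x <= kothe_fnorm x.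
Proof.
move=> uF xk; have /kothe_fnorm_leP/(_ k F uF)/orP[|//] := lexx (kothe_fnorm x).
by rewrite leNgt xk.
Qed.

Lemma kothe_fnormD x y : kothe_fnorm (x + y) <= kothe_fnorm x + kothe_fnorm y.
Proof.
have x0 := kothe_fnorm_ge0 x; have y0 := kothe_fnorm_ge0 y.
apply/kothe_fnorm_leP => k F uF.
have /kothe_fnorm_leP/(_ k F uF)/orP[h|h] := lexx (kothe_fnorm x).
  by rewrite (le_trans h)// lerDl.
have /kothe_fnorm_leP/(_ k F uF)/orP[h'|h'] := lexx (kothe_fnorm y).
  by rewrite (le_trans h')// lerDr.
by apply/orP; right; rewrite kothe_valD (le_trans (kothe_partD _ _ _ _))// lerD.
Qed.

Lemma kothe_fnormN x : kothe_fnorm (- x) = kothe_fnorm x.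
Proof.
rewrite /kothe_fnorm (_ : kothe_min (- x) = kothe_min x)//.
by apply/funext => kF; rewrite /kothe_min kothe_partN.
Qed.

Lemma kothe_fnorm0 : kothe_fnorm 0 = 0.
Proof.
apply/eqP; rewrite eq_le kothe_fnorm_ge0 andbT; apply/kothe_fnorm_leP => k F _.
by rewrite kothe_part0 lexx orbT.
Qed.

Lemma kothe_fnorm_eq0 x : kothe_fnorm x = 0 -> x = 0.
Proof.
move=> x0; apply: kothe_ext => t; apply/eqP; rewrite -normr_le0.
have := @kothe_fnorm_part x 0%N [:: t] isT.
rewrite x0 invr1 ltr01 => /(_ isT); rewrite /kothe_part /= symnorm1 normrM.
by rewrite pmulr_rle0// gtr0_norm// kothe_weight_gt0.
Qed.

(** The function min(c, p_k) is quasi-convex although not convex: hence the balls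
    of the metric are convex, which gives local convexity. *)
Lemma kothe_fnorm_convex (x y : kothe) (l e : R) : 0 <= l <= 1 ->
  kothe_fnorm x < e -> kothe_fnorm y < e -> kothe_fnorm (l *: x + (1 - l) *: y) < e.
Proof.
move=> /andP[l0 l1] xe ye; pose m := Num.max (kothe_fnorm x) (kothe_fnorm y).
apply: (@le_lt_trans _ _ m); last by rewrite gt_max xe.
have /kothe_fnorm_leP xm : kothe_fnorm x <= m by rewrite le_max lexx.
have /kothe_fnorm_leP ym : kothe_fnorm y <= m by rewrite le_max lexx orbT.
apply/kothe_fnorm_leP => k F uF.
have /orP[->//|h] := xm k F uF; have /orP[->//|h'] := ym k F uF.
apply/orP; right; rewrite kothe_valD (le_trans (kothe_partD _ _ _ _))//.
rewrite !kothe_valZ !kothe_partZ !ger0_norm ?subr_ge0//.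
have -> : m = l * m + (1 - l) * m by ring.
by rewrite lerD// ler_wpM2l// subr_ge0.
Qed.

Lemma kothe_fnormZ_le (c L : R) x : 1 <= L -> `|c| <= L ->
  kothe_fnorm (c *: x) <= L * kothe_fnorm x.
Proof.
move=> L1 cL; apply/kothe_fnorm_leP => k F uF.
have x0 := kothe_fnorm_ge0 x.
have /kothe_fnorm_leP/(_ k F uF)/orP[h|h] := lexx (kothe_fnorm x).
  by rewrite (le_trans h)// ler_peMl.
by rewrite kothe_valZ kothe_partZ ler_pM ?orbT// kothe_part_ge0.
Qed.

(** The seminorms with 1/(k+1) <= e are irrelevant at precision e. *)
Lemma kothe_fnorm_le_finite (e : R) : 0 < e -> exists K : nat, forall x : kothe,
  (forall k F, (k < K)%N -> uniq F -> kothe_part k F x <= e) -> kothe_fnorm x <= e.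
Proof.
move=> e0; have [K HK] := archimedean_inv_lt e0; exists K => x xe.
apply/kothe_fnorm_leP => k F uF; have [Kk|kK] := leqP K k.
  by rewrite ltW// HK.
by rewrite xe ?orbT.
Qed.

Lemma kothe_fnormZ_cvg0 x (e : R) : 0 < e ->
  exists2 d : R, 0 < d & forall c, `|c| <= d -> kothe_fnorm (c *: x) <= e.
Proof.
move=> e0; have [K HK] := kothe_fnorm_le_finite e0.
have [M HM] := choice (kotheP x).
have M0 k : 0 <= M k by apply: le_trans (HM k [::] isT); exact: kothe_part_ge0.
pose S := 1 + \sum_(k < K) M k.
have S0 : 0 < S by rewrite ltr_pwDl// sumr_ge0.
exists (e / S); first by rewrite divr_gt0.
move=> c ce; apply: HK => k F kK uF; rewrite kothe_valZ kothe_partZ.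
have MS : M k <= S.
  rewrite /S (bigD1 (Ordinal kK))//= addrCA lerDl addr_ge0// sumr_ge0//.
have -> : e = (e / S) * S by rewrite divfK// gt_eqF.
by rewrite ler_pM ?kothe_part_ge0// (le_trans (HM _ _ uF)).
Qed.

Definition kothe_dist (x y : kothe) : R := kothe_fnorm (x - y).

Lemma kothe_distxx x : kothe_dist x x = 0.
Proof. by rewrite /kothe_dist subrr kothe_fnorm0. Qed.

Lemma kothe_dist_eq0 x y : kothe_dist x y = 0 -> x = y.
Proof. by move=> /kothe_fnorm_eq0/eqP; rewrite subr_eq0 => /eqP. Qed.

Lemma kothe_distC x y : kothe_dist x y = kothe_dist y x.
Proof. by rewrite /kothe_dist -kothe_fnormN opprB. Qed.

Lemma kothe_dist_triangle y x z : kothe_dist x z <= kothe_dist x y + kothe_dist y z.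
Proof.
by rewrite (le_trans _ (kothe_fnormD _ _))// addrA subrK.
Qed.

HB.instance Definition _ := isMetric.Build R kothe
  kothe_distxx kothe_dist_eq0 kothe_distC kothe_dist_triangle.

Lemma kothe_ballE (x y : kothe) e : ball x e y = (kothe_fnorm (x - y) < e).
Proof. by rewrite ballEmdist. Qed.

Lemma kothe_add_continuous : continuous (fun z : kothe * kothe => z.1 + z.2).
Proof.
move=> [x y] U /nbhs_ballP[e /= e0 eU].
have e2 : 0 < e / 2 by lra.
exists (ball x (e / 2), ball y (e / 2)); first by split; exact: nbhsx_ballx.
move=> [x' y'] /= []; rewrite !kothe_ballE => h h'; apply: eU.
rewrite kothe_ballE opprD addrACA (le_lt_trans (kothe_fnormD _ _))//; lra.
Qed.

Lemma kothe_scale_continuous : continuous (fun z : R^o * kothe => z.1 *: z.2).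
Proof.
move=> [c x] U /nbhs_ballP[e /= e0 eU].
have e2 : 0 < e / 2 by lra.
have [d d0 Hd] := kothe_fnormZ_cvg0 x e2.
pose L := `|c| + 1.
have L1 : 1 <= L by rewrite lerDr.
exists (ball c (Num.min 1 d), ball x (e / 2 / L)).
  by split; apply: nbhsx_ballx; rewrite ?divr_gt0 ?lt_min ?ltr01// (lt_le_trans ltr01).
move=> [c' x'] /= []; rewrite kothe_ballE => h h'; apply: eU.
have {h} : `|c - c'| < Num.min 1 d by exact: h.
rewrite lt_min => /andP[c1 cd]; rewrite kothe_ballE.
have -> : c *: x - c' *: x' = (c - c') *: x + c' *: (x - x').
  by rewrite scalerBl scalerBr addrA subrK.
rewrite (le_lt_trans (kothe_fnormD _ _))//.
have := Hd _ (ltW cd).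
have c'L : `|c'| <= L.
  rewrite (_ : c' = c - (c - c')); last by ring.
  by rewrite (le_trans (ler_normB _ _))// lerD2l ltW.
have := kothe_fnormZ_le (x - x') L1 c'L.
have : L * kothe_fnorm (x - x') < e / 2.
  by rewrite -ltr_pdivlMl ?(lt_le_trans ltr01)// mulrC.
lra.
Qed.

Lemma kothe_locally_convex :
  exists2 B : set_system kothe, (forall b, b \in B -> convex_set b) & basis B.
Proof.
exists [set B | exists x r, B = ball x r].
  move=> B/= /[!inE]/= [[x]] [r] -> y z l.
  rewrite !inE !kothe_ballE => xy xz.
  have -> : x - conv l y z = l%:num *: (x - y) + (1 - l%:num) *: (x - z).
    rewrite !scalerBr addrACA -scalerDl -opprD (addrC l%:num) subrK scale1r.
    by congr (_ - _).
  by apply: kothe_fnorm_convex => //; apply/andP; split.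
split.
  move=> B [x] [r] ->; rewrite openE => y; rewrite kothe_ballE => xy.
  apply/nbhs_ballP; exists (r - kothe_fnorm (x - y)) => /=; first by rewrite subr_gt0.
  move=> z; rewrite !kothe_ballE ltrBrDl; apply: le_lt_trans.
  exact: kothe_dist_triangle.
move=> x B; rewrite -nbhs_ballE/= => -[r] r0 Bxr /=.
by exists (ball x r) => //=; split; [exists x, r|exact: ballxx].
Qed.

HB.instance Definition _ :=
  PreTopologicalNmodule_isTopologicalNmodule.Build kothe kothe_add_continuous.
HB.instance Definition _ :=
  TopologicalNmodule_isTopologicalLmodule.Build R kothe kothe_scale_continuous.
HB.instance Definition _ :=
  Uniform_isTvs.Build R kothe kothe_locally_convex.

End kothe_space.


Section kothe_theory.
Context (R : realType) (I : countType) (rho : symnorm R) (a : kothe_matrix R I).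
Local Notation Y := (kothe rho a).
Local Notation part := (kothe_part rho a).

Lemma kothe_part_single_le (x : I -> R) t k F : t \in F ->
  `|x t| <= part k F x / a k t.
Proof.
move=> tF; have at0 := kothe_weight_gt0 a k t.
rewrite ler_pdivlMr// mulrC -(gtr0_norm at0) -normrM.
exact: (@symnorm_mem_le _ rho _ F (fun t => a k t * x t) t tF).
Qed.

Lemma kothe_part_lim k F (z : nat -> I -> R) (y : I -> R) M :
  (forall t e, 0 < e -> exists N, forall n, (N <= n)%N -> `|y t - z n t| <= e) ->
  (exists N, forall n, (N <= n)%N -> part k F (z n) <= M) -> part k F y <= M.
Proof.
move=> zy zM; apply: (symnorm_lim (z := fun n t => a k t * z n t)) => // t e e0.
have at0 := kothe_weight_gt0 a k t.
have [|N HN] := zy t (e / a k t); first by rewrite divr_gt0.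
exists N => n /HN; rewrite ler_pdivlMr// => h.
by rewrite -mulrBr normrM gtr0_norm// mulrC.
Qed.

Lemma kothe_partB k F (x y : I -> R) : part k F (x - y) <= part k F x + part k F y.
Proof. by rewrite (le_trans (kothe_partD _ _ _ _ _ _))// kothe_partN. Qed.

Lemma kothe_is_metric : is_metric (@kothe_dist _ _ rho a).
Proof.
split; [exact: kothe_distxx|exact: kothe_dist_eq0|exact: kothe_distC|].
by move=> x y z; exact: kothe_dist_triangle.
Qed.

Lemma kothe_induces_topology : induces_topology (@kothe_dist _ _ rho a).
Proof.
move=> x; rewrite -nbhs_ballE /nbhs_ball /nbhs_ball_.
by congr filter_from; apply/funext => e; rewrite ballEmdist.
Qed.

Lemma kothe_dist_complete : complete_metric (@kothe_dist _ _ rho a).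
Proof.
move=> u cu.
have coord t : exists l, forall e, 0 < e -> exists N : nat,
    forall n, (N <= n)%N -> `|l - u n t| <= e.
  apply: real_cauchy_cvg => e e0; have at0 := kothe_weight_gt0 a 0 t.
  have m0 : 0 < Num.min 1 (e * a 0%N t) by rewrite lt_min ltr01 mulr_gt0.
  have [N HN] := cu _ m0; exists N => m n Nm Nn.
  have := HN m n Nm Nn; rewrite lt_min => /andP[d1 de].
  apply: (le_trans (kothe_part_single_le (u m - u n) 0 (mem_head t [::]))).
  rewrite ler_pdivrMr// (le_trans _ (ltW de))// kothe_fnorm_part//.
  by rewrite invr1.
have [y Hy] := choice coord.
have near_y e k : 0 < e -> exists N, forall n, (N <= n)%N -> forall F,
    uniq F -> part k F (y - kothe_val (u n)) <= e.
  move=> e0.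
  have m0 : 0 < Num.min k.+1%:R^-1 e by rewrite lt_min e0 invr_gt0 ltr0Sn.
  have [N HN] := cu _ m0; exists N => n Nn F uF.
  apply: (kothe_part_lim (z := fun m => kothe_val (u m) - kothe_val (u n))).
    move=> t d /(Hy t)[K HK]; exists K => m /HK.
    by rewrite /= opprB addrA subrK.
  exists N => m Nm; have := HN m n Nm Nn; rewrite lt_min => /andP[dk de].
  by rewrite (le_trans _ (ltW de))//; apply: (@kothe_fnorm_part _ _ rho a (u m - u n)).
have yP : y \in kothe_pred rho a.
  rewrite inE /= => k; have [N /(_ N (leqnn N)) HN] := near_y 1 k ltr01.
  have [M HM] := kotheP (u N) k; exists (1 + M) => F uF.
  rewrite -[y](subrK (kothe_val (u N))).
  by rewrite (le_trans (kothe_partD _ _ _ _ _ _))// lerD ?HN ?HM.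
exists (Kothe yP); apply/(induces_topology_cvgP _ _ kothe_is_metric kothe_induces_topology).
move=> e e0; have e2 : 0 < e / 2 by lra.
have [K HK] := kothe_fnorm_le_finite rho a e2.
have [N HN] := @eventually_in_seq _ (iota 0 K) (fun k n => forall F,
    uniq F -> part k F (y - kothe_val (u n)) <= e / 2) (fun k _ => near_y _ k e2).
exists N => n Nn; apply: (@le_lt_trans _ _ (e / 2)); last by lra.
by apply: HK => k F kK uF; apply: HN => //; rewrite mem_iota.
Qed.

Lemma kothe_frechet : frechet Y.
Proof.
split; first by exists (@kothe_dist _ _ rho a); split;
  [exact: kothe_is_metric|exact: kothe_induces_topology|exact: kothe_dist_complete].
exists (@kothe_dist _ _ rho a); split;
  [exact: kothe_is_metric|exact: kothe_induces_topology|].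
by move=> x y z; rewrite /kothe_dist opprD addrACA subrr addr0.
Qed.

Lemma symnorm_map_sum (F : seq I) n (w : nat -> I -> R) :
  rho [seq \sum_(i < n) w i t | t <- F] <= \sum_(i < n) rho (map (w i) F).
Proof.
elim: n => [|n IH].
  rewrite big_ord0 (eq_map (_ : _ =1 fun t => 0 * 0)); last first.
    by move=> t; rewrite big_ord0 mul0r.
  by rewrite symnorm_mapZ normr0 mul0r.
rewrite big_ord_recr /= (eq_map (fun t => big_ord_recr _ _)).
by rewrite (le_trans (symnorm_mapD _ _ _ _))// lerD2r.
Qed.

(** No infinite set of indices carries weights that are all comparable to the
    k-th one. This is the Dieudonne-Gomes criterion for a Koethe space to be a
    Montel space. *)
Definition montel_matrix := forall (k : nat) (N : nat -> R), exists J : seq I,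
  forall t, (forall k', a k' t <= N k' * a k t) -> t \in J.

Hypothesis am : montel_matrix.

(** On a bounded set the k-th seminorm is uniformly small off a finite set J.  Let
    J be the set of the t with a_i(t) <= N_i a_k(t) for all i.  Off J the function
    a_k |z| is at most sum_i a_i |z| / N_i, and N_i is chosen so large that the
    i-th term has norm at most e 2^-(i+1). *)
Lemma kothe_part_tail (M : nat -> R) k (e : R) : 0 < e -> exists J : seq I,
  forall (z : I -> R), (forall k F, uniq F -> part k F z <= M k) ->
  forall F, uniq F -> {in F, forall t, t \notin J} -> part k F z <= e.
Proof.
move=> e0; pose N i := (`|M i| + 1) * 2 ^+ i.+1 / e.
have N0 i : 0 < N i by rewrite divr_gt0// mulr_gt0 ?ltr_wpDl// exprn_gt0.
have [J HJ] := am k N; exists J => z zM F uF FJ.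
have [n Hn] : exists n, forall t, t \in F ->
    exists2 i, (i < n)%N & N i * a k t < a i t.
  have [|n Hn] := @eventually_in_seq _ F (fun t n => exists2 i, (i < n)%N & N i * a k t < a i t).
    move=> t tF; have /negP tJ := FJ t tF.
    have [i Hi] : exists i, N i * a k t < a i t.
      apply: contrapT => /forallNP h; apply/tJ/HJ => i.
      by rewrite leNgt; apply/negP; exact: h.
    by exists i.+1 => n im; exists i.
  by exists n; exact: Hn.
have part_sum i : rho [seq (N i)^-1 * (a i t * `|z t|) | t <- F] <= e * 2^-1 ^+ i.+1.
  rewrite symnorm_mapZ ger0_norm ?invr_ge0 ?(ltW (N0 i))// ler_pdivrMl//.
  apply: (@le_trans _ _ (part i F z)).
    by apply: symnorm_map_le => t _; rewrite !normrM normr_id.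
  rewrite (le_trans (zM i F uF))// (_ : N i * _ = `|M i| + 1); last first.
    rewrite /N exprVn; field; rewrite expf_neq0//=; lra.
  by rewrite (le_trans (ler_norm _))// lerDl.
have geo : \sum_(i < n) e * 2^-1 ^+ i.+1 <= e.
  rewrite -mulr_sumr -[leRHS]mulr1 ler_wpM2l ?(ltW e0)//.
  suff -> : \sum_(i < n) 2^-1 ^+ i.+1 = 1 - 2^-1 ^+ n :> R.
    by have : 0 < 2^-1 ^+ n :> R by [rewrite exprn_gt0]; lra.
  elim: n {Hn} => [|n IH]; first by rewrite big_ord0 expr0 subrr.
  by rewrite big_ord_recr /= IH exprS; lra.
apply: le_trans geo; pose w i t := (N i)^-1 * (a i t * `|z t|).
apply: (@le_trans _ _ (\sum_(i < n) rho (map (w i) F))); last first.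
  by apply: ler_sum => i _; exact: part_sum.
apply: le_trans (symnorm_map_sum _ _ _).
apply: symnorm_map_le => t tF; have [i iN Ni] := Hn t tF.
have at0 j : 0 < a j t by exact: kothe_weight_gt0.
have term0 j : 0 <= (N j)^-1 * (a j t * `|z t|).
  by rewrite !mulr_ge0// ?invr_ge0 ltW.
rewrite /= [leRHS]ger0_norm; last by apply: sumr_ge0 => j _; exact: term0.
rewrite (bigD1 (Ordinal iN))//=.
rewrite normrM gtr0_norm//; apply: ler_wpDr; first by apply: sumr_ge0 => j _; exact: term0.
by rewrite /w mulrA ler_wpM2r// ler_pdivlMl// ltW.
Qed.

(** On bounded sets the topology is that of coordinatewise convergence.  Both the
    compactness of closed bounded sets and separability follow from this. *)
Lemma kothe_fnorm_bounded_small (M : nat -> R) (e : R) : 0 < e ->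
  exists (J : seq I) (d : R), 0 < d /\
  forall z : Y, (forall k F, uniq F -> part k F z <= M k) ->
  (forall t, t \in J -> `|z t| <= d) -> kothe_fnorm z <= e.
Proof.
move=> e0; have [K HK] := kothe_fnorm_le_finite rho a e0.
have e2 : 0 < e / 2 by lra.
have [Jk HJk] := choice (fun k => kothe_part_tail M k e2).
pose J := flatten [seq Jk k | k <- iota 0 K].
pose A := \sum_(k < K) \sum_(t <- J) a k t.
have A0 : 0 <= A.
  by apply: sumr_ge0 => k _; apply: sumr_ge0 => t _; apply/ltW/kothe_weight_gt0.
exists J, (e / 2 / (1 + A)); split; first by rewrite divr_gt0//; lra.
move=> z zM zJ; apply: HK => k F kK uF.
pose z1 t := if t \in J then z t else 0.
pose z2 t := if t \in J then 0 else z t.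
have zE : kothe_val z = (z1 : I -> R) + z2.
  by apply/funext => t; rewrite -[RHS]/(z1 t + z2 t) /z1 /z2; case: ifP => _; rewrite ?addr0 ?add0r.
have h1 : part k F z1 <= e / 2.
  rewrite /kothe_part -(@symnorm_map_filter _ rho _ (mem J)); last first.
    by move=> t _ /negbTE /= tJ; rewrite /z1 tJ mulr0.
  apply: (le_trans (@symnorm_map_subset _ rho _ _ J _ _ _)).
  - by rewrite filter_uniq.
  - by move=> t; rewrite mem_filter => /andP[].
  apply: (le_trans (symnorm_le_sum _ _ _)).
  apply: (@le_trans _ _ (\sum_(t <- J) a k t * (e / 2 / (1 + A)))).
    rewrite big_seq [leRHS]big_seq; apply: ler_sum => t tJ.
    have at0 := kothe_weight_gt0 a k t.
    by rewrite normrM gtr0_norm// ler_wpM2l ?(ltW at0)// /z1 tJ zJ.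
  rewrite -mulr_suml mulrA ler_pdivrMr; last by lra.
  rewrite mulrC ler_wpM2l ?(ltW e2)//.
  rewrite /A (bigD1 (Ordinal kK))//= addrCA lerDl addr_ge0// sumr_ge0// => i _.
  by apply: sumr_ge0 => t _; apply/ltW/kothe_weight_gt0.
have h2 : part k F z2 <= e / 2.
  rewrite /kothe_part -(@symnorm_map_filter _ rho _ (fun t => t \notin J)); last first.
    by move=> t _ /negPn tJ; rewrite /z2 /= tJ mulr0.
  apply: (@le_trans _ _ (part k [seq t <- F | t \notin J] z)).
    apply: symnorm_map_le => t; rewrite mem_filter => /andP[/negbTE tJ _].
    by rewrite /z2 tJ.
  apply: HJk => //; first by rewrite filter_uniq.
  move=> t; rewrite mem_filter => /andP[tJ _]; apply: contra tJ => tk.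
  by apply/flattenP; exists (Jk k) => //; apply: map_f; rewrite mem_iota.
rewrite zE (le_trans (kothe_partD _ _ _ _ _ _))//; lra.
Qed.

Lemma filter_in_seq (T : Type) (G : set_system T) (FG : Filter G)
    (A : I -> set T) (J : seq I) :
  (forall t, t \in J -> G (A t)) -> G [set x | forall t, t \in J -> A t x].
Proof.
elim: J => [|u J IH] GA; first by apply: filterS filterT => x _ t.
have GuJ := @filterI _ _ FG _ _ (GA u (mem_head _ _))
  (IH (fun t tJ => GA t (mem_behead (s := u :: J) tJ))).
apply: filterS GuJ => x [Au AJ] t.
by rewrite inE => /predU1P[->//|]; exact: AJ.
Qed.

Lemma kothe_nbhs_part (k : nat) :
  nbhs (0 : Y) [set z : Y | forall F, uniq F -> part k F z <= 1].
Proof.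
apply/nbhs_ballP; exists k.+1%:R^-1 => /=; first by rewrite invr_gt0.
move=> z; rewrite kothe_ballE sub0r kothe_fnormN => zk F uF.
rewrite (le_trans (kothe_fnorm_part uF zk))// (le_trans (ltW zk))//.
by rewrite invf_le1// ler1n.
Qed.

Lemma kothe_bounded_part (K : set Y) k : tvs_bounded K ->
  exists M, forall z, K z -> forall F, uniq F -> part k F z <= M.
Proof.
move=> /(_ _ (kothe_nbhs_part k))[c Kc]; exists `|c| => _ /Kc[u Hu <-] F uF.
by rewrite kothe_valZ kothe_partZ -[leRHS]mulr1 ler_wpM2l// Hu.
Qed.

(** An ultrafilter on a bounded set converges coordinatewise, the coordinates being
    bounded; the limit satisfies the same bounds by semicontinuity, and on a
    bounded set coordinatewise convergence is enough. *)
Lemma kothe_montel : montel Y.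
Proof.
split; first exact: kothe_frechet.
move=> K Kcl Kb.
have [M HM] := choice (fun k => kothe_bounded_part k Kb).
rewrite compact_ultra => G UG GK.
have coord t : exists l : R, forall e, 0 < e -> G [set x : Y | `|l - x t| <= e].
  have at0 := kothe_weight_gt0 a 0 t.
  pose C := M 0%N / a 0%N t.
  have GC : ((fun x : Y => x t) @ G) `[- C, C]%classic.
    suff : G [set x : Y | `[- C, C]%classic (x t)] by [].
    apply: filterS GK => x Kx /=; rewrite in_itv /= -ler_norml.
    apply: (le_trans (kothe_part_single_le x 0 (mem_head t [::]))).
    by rewrite ler_wpM2r ?invr_ge0 ?(ltW at0)// HM.
  have [l [_ cl]] := @segment_compact R (- C) C ((fun x : Y => x t) @ G) _ GC.
  exists l => e e0; have [//|GN] := in_ultra_setVsetC [set x : Y | `|l - x t| <= e] UG.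
  have [r [/= h1 h2]] := cl (~` [set r | `|l - r| <= e]) (ball l e) GN (nbhsx_ballx _ _ e0).
  by exfalso; apply: h1; exact: ltW.
have [y Hy] := choice coord.
have y_part k F : uniq F -> part k F y <= M k.
  move=> uF; apply: symnorm_fatou => e e0.
  have GF : G [set x : Y | forall t, t \in F -> `|y t - x t| <= e / a k t].
    apply: filter_in_seq => t _; apply: Hy.
    by rewrite divr_gt0// kothe_weight_gt0.
  have [x [Kx xF]] := filter_ex (filterI GK GF).
  exists (fun t => a k t * x t); last exact: HM.
  move=> t /xF; rewrite -mulrBr normrM gtr0_norm ?kothe_weight_gt0//.
  by rewrite ler_pdivlMr ?kothe_weight_gt0// mulrC.
have yP : y \in kothe_pred rho a by rewrite inE /= => k; exists (M k) => F; exact: y_part.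
pose l : Y := Kothe yP.
have Gl : G --> l.
  move=> U /nbhs_ballP[e /= e0 eU].
  have e2 : 0 < e / 2 by lra.
  have [J [d [d0 HJ]]] := kothe_fnorm_bounded_small (fun k => M k + M k) e2.
  have GJ : G [set x : Y | forall t, t \in J -> `|y t - x t| <= d].
    by apply: filter_in_seq => t _; exact: Hy.
  apply: filterS (filterI GK GJ) => x [Kx xJ]; apply: eU; rewrite kothe_ballE.
  apply: (@le_lt_trans _ _ (e / 2)); last by lra.
  apply: HJ => [k F uF|t /xJ//].
  by rewrite (le_trans (kothe_partB _ _ _ _))// lerD ?y_part ?HM.
exists l; split => //.
apply: Kcl => U /Gl GU; exact: filter_ex (filterI GK GU).
Qed.

(** By the second bound, replacing coordinates of a vector with rational numbers
    causes an error that satisfies the same seminorm bounds as the vector. *)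
Lemma kothe_rat_approx (x : R) (d : R) : 0 < d ->
  exists c : rat, `|x - ratr c| <= d /\ `|x - ratr c| <= `|x|.
Proof.
move=> d0; have [->|x0] := eqVneq x 0.
  by exists 0; rewrite rmorph0 subrr normr0; split => //; exact: ltW.
have m0 : 0 < Num.min d `|x| by rewrite lt_min d0 normr_gt0.
have [|c] := @rat_in_itvoo R (x - Num.min d `|x|) (x + Num.min d `|x|); first by lra.
rewrite in_itv/= => h; exists c.
have : `|x - ratr c| <= Num.min d `|x| by rewrite ler_norml; lra.
by rewrite le_min => /andP.
Qed.

Definition finite_support_fun (s : seq (I * rat)) : I -> R :=
  fun t => \sum_(p <- s | p.1 == t) ratr p.2.

Lemma finite_support_fun_pred s : finite_support_fun s \in kothe_pred rho a.
Proof.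
rewrite inE /= => k.
exists (\sum_(t <- undup (map fst s)) `|a k t * finite_support_fun s t|) => F uF.
rewrite /kothe_part -(@symnorm_map_filter _ rho _ (mem (map fst s))); last first.
  move=> t _ /= ts; rewrite /finite_support_fun big1_seq ?mulr0// => p /andP[/eqP pt ps].
  by move: ts; rewrite -pt map_f.
apply: (le_trans (@symnorm_map_subset _ rho _ _ (undup (map fst s)) _ _ _)).
- by rewrite filter_uniq.
- by move=> t; rewrite mem_filter mem_undup => /andP[].
exact: symnorm_le_sum.
Qed.

Lemma kothe_separable : separable Y.
Proof.
pose h s : Y := Kothe (finite_support_fun_pred s).
exists (h @` setT); first exact: sub_countable (card_image_le _ _) (countableP _).
move=> O [x Ox] Oo.
have /nbhs_ballP[e /= e0 eO] : nbhs x O by exact: open_nbhs_nbhs.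
have e2 : 0 < e / 2 by lra.
have [M HM] := choice (kotheP x).
have [J [d [d0 HJ]]] := kothe_fnorm_bounded_small M e2.
have [c Hc] := choice (fun t => kothe_rat_approx (x t) d0).
pose s := [seq (t, c t) | t <- undup J].
have hs t : h s t = if t \in J then ratr (c t) else 0.
  rewrite /= /finite_support_fun /s big_map /= -mem_undup; case: ifP => tJ.
    by rewrite -big_filter filter_pred1_uniq ?undup_uniq// big_seq1.
  by rewrite big1_seq// => u /andP[/eqP -> ]; rewrite tJ.
exists (h s); split; last by exists s.
apply: eO; rewrite kothe_ballE; apply: (@le_lt_trans _ _ (e / 2)); last by lra.
apply: HJ => [k F uF|t tJ].
  apply: le_trans (HM k F uF); apply: symnorm_map_le => t _.
  rewrite !normrM ler_wpM2l//; have := hs t.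
  rewrite -[X in `|X| <= _]/(x t - h s t) => ->.
  by case: ifP => _; [case: (Hc t)|rewrite subr0].
rewrite -[X in `|X| <= _]/(x t - h s t) hs tJ; by case: (Hc t).
Qed.

End kothe_theory.

(** * The Koethe space of a tree *)

Section tree.
Context (E : eqType).

Fixpoint grow (next : seq E -> E) n : seq E :=
  if n is n'.+1 then rcons (grow next n') (next (grow next n')) else [::].

Lemma size_grow next n : size (grow next n) = n.
Proof. by elim: n => //= n IH; rewrite size_rcons IH. Qed.

Lemma take_grow next m n : (m <= n)%N -> take m (grow next n) = grow next m.
Proof.
elim: n => [|n IH]; first by rewrite leqn0 => /eqP->.
rewrite leq_eqVlt => /predU1P[->|mn]; first by rewrite take_oversize// size_grow.
by rewrite /= -cats1 takel_cat ?size_grow// IH.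
Qed.

Lemma nth_grow e0 next l n : (l < n)%N -> nth e0 (grow next n) l = next (grow next l).
Proof.
move=> ln; rewrite -(nth_take e0 (ltnSn l)) take_grow//= nth_rcons size_grow.
by rewrite ltnn eqxx.
Qed.

Lemma grow_mkseq next n : grow next n = mkseq (fun l => next (grow next l)) n.
Proof. by elim: n => //= n IH; rewrite mkseqS -IH. Qed.

Definition ill_founded (T : set (seq E)) := exists s : nat -> E, forall n, T (mkseq s n).

End tree.

Section tree_matrix.
Context (R : realType) (E : countType) (delay : E -> nat).

(** The letter that follows e is visible at the levels k >= [delay e]; d is the delay
    that applies to the first letter. *)
Fixpoint visible_code (k d : nat) (t : seq E) : nat :=
  if t is e :: t' then ((if d <= k then pickle e else 0) + visible_code k (delay e) t')%N
  else 0%N.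

Lemma visible_code_cat k d s t : visible_code k d (s ++ t) =
  (visible_code k d s + visible_code k (last d (map delay s)) t)%N.
Proof. by elim: s d => //= e s IH d; rewrite IH addnA. Qed.

Lemma visible_code_mono k k' d t : (k <= k')%N ->
  (visible_code k d t <= visible_code k' d t)%N.
Proof.
move=> kk'; elim: t d => //= e t IH d; apply: leq_add (IH _).
by case: ifP => // dk; rewrite (leq_trans dk kk').
Qed.

(** The level k also multiplies the exponent, so that between two levels the
    quotient of the weights grows with the code of each letter visible at the
    higher one, even if that letter is visible at the lower one too. *)
Definition tree_weight k (t : seq E) : R := 2 ^+ (k * visible_code k 0 t).

Context (T : set (seq E)).

Local Notation I := {t : seq E | `[< T t >]}.

Lemma tree_weight_gt0 k (t : I) : 0 < tree_weight k (val t).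
Proof. by rewrite exprn_gt0. Qed.

Definition tree_matrix : kothe_matrix R I := KotheMatrix tree_weight_gt0.

Hypothesis T_prefix : forall s t, T (s ++ t) -> T s.

(** Koenig's lemma.  Suppose that infinitely many nodes with comparable weights
    extend s.  Their next letter after s is visible at some level k' > k, so that
    comparability at the level k' bounds its code.  Hence there are only
    finitely many such letters, and infinitely many of the nodes share one of
    them. *)
Lemma tree_matrix_montel (e0 : E) : ~ ill_founded T -> montel_matrix tree_matrix.
Proof.
move=> wf k N; apply: contrapT => infinite; apply: wf.
pose S t := T t /\ forall k', tree_weight k' t <= N k' * tree_weight k t.
pose big s := ~ exists L : seq (seq E), forall t, S (s ++ t) -> s ++ t \in L.
have big_next s : exists e, big s -> big (rcons s e).
  have [bs|nbs] := pselect (big s); last first.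
    by exists e0.
  apply: contrapT => /forallNP small; apply: bs.
  have {}small e : exists L : seq (seq E), forall t, S (rcons s e ++ t) -> rcons s e ++ t \in L.
    by apply: contrapT => be; apply: (small e).
  have [L HL] := choice small.
  pose k' := (maxn k (last 0%N (map delay s))).+1.
  pose m := Num.trunc (N k').
  exists (s :: flatten [seq L e | e <- pmap unpickle (iota 0 m.+1)]) => -[|e t].
    by rewrite cats0 mem_head.
  rewrite -cat_rcons => St; rewrite inE; apply/orP; right.
  apply/flattenP; exists (L e); last exact: HL.
  apply: map_f; rewrite mem_pmap; apply/mapP; exists (pickle e); last by rewrite pickleK.
  rewrite mem_iota /= add0n ltnS.
  have [_ /(_ k')] := St; rewrite /tree_weight.
  set V' := visible_code k' 0 _; set V := visible_code k 0 _ => h.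
  have VV' : (V <= V')%N by apply: visible_code_mono; rewrite /k'; lia.
  have eV' : (pickle e <= V')%N.
    rewrite /V' cat_rcons visible_code_cat /= ifT; last by rewrite /k'; lia.
    lia.
  have {h} h : 2 ^+ V' <= N k'.
    have k0 : 0 < 2 ^+ (k * V) :> R by rewrite exprn_gt0.
    rewrite -(ler_pM2r k0); apply: le_trans h; rewrite -exprD.
    apply: ler_weXn2l; first by rewrite ler1n.
    have : (k.+1 <= k')%N by rewrite /k'; lia.
    nia.
  rewrite truncn_ge_nat; last by rewrite (le_trans _ h)// exprn_ge0.
  rewrite (le_trans _ h)// -natrX ler_nat (leq_trans eV')// ltnW// ltn_expl//.
have [next Hnext] := choice big_next.
exists (fun n => next (grow next n)) => n; rewrite -grow_mkseq.
have big_grow : big (grow next n).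
  elim: n => [|n IH] /=; last exact: Hnext.
  move=> [L HL]; apply: infinite; exists (pmap insub L) => t tN.
  rewrite mem_pmap_sub; apply: HL; split; last exact: tN.
  by have /asboolP := valP t.
apply: contrapT => nT; apply: big_grow; exists [::] => t [Tt _].
by exfalso; apply: nT; exact: T_prefix Tt.
Qed.

Definition unit_fun (s : seq E) : I -> R := fun t => (val t == s)%:R.

Context (rho : symnorm R).

Lemma unit_fun_pred s : unit_fun s \in kothe_pred rho tree_matrix.
Proof.
have [Ts|nTs] := boolP `[< T s >]; last first.
  rewrite (_ : unit_fun s = 0) ?rpred0//; apply/funext => t; rewrite /unit_fun.
  by case: eqP => // ts; move: nTs; rewrite -ts (valP t).
pose t0 : I := exist _ s Ts.
rewrite (_ : unit_fun s = @finite_support_fun R _ [:: (t0, 1)]).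
  exact: finite_support_fun_pred.
apply/funext => t; rewrite /finite_support_fun /unit_fun.
rewrite big_cons big_nil /=.
have -> : (t0 == t) = (val t == s) by rewrite -val_eqE eq_sym.
by case: eqP => _ /=; rewrite ?rmorph1 ?addr0.
Qed.

Definition unit_vector s : kothe rho tree_matrix := Kothe (unit_fun_pred s).

Lemma branch_combinationE (next : seq E -> E) (x : nat -> R) n (t : I) :
  (\sum_(0 <= i < n) x i *: unit_vector (grow next i)) t =
  if (size (val t) < n)%N && (val t == grow next (size (val t)))
  then x (size (val t)) else 0.
Proof.
elim: n => [|n IH]; first by rewrite big_geq.
rewrite big_nat_recr//= -[LHS]/((\sum_(0 <= i < n) x i *: unit_vector (grow next i)) t
  + x n * (val t == grow next n)%:R) IH ltnS.
have ne : size (val t) != n -> (val t == grow next n) = false.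
  by move=> h; apply/eqP => E'; move: h; rewrite E' size_grow eqxx.
have [tn|tn|tn] := ltngtP (size (val t)) n.
- by rewrite ne ?ltn_eqF// mulr0 addr0.
- by rewrite ne ?gtn_eqF// mulr0 addr0.
- by rewrite tn add0r /=; case: eqP => _; rewrite ?mulr1 ?mulr0.
Qed.

(** The nodes of a branch are told apart by their lengths, so that a
    combination of their unit vectors has the norm of its coefficients, up to the
    largest weight met. *)
Lemma branch_part_le (next : seq E -> E) (x : nat -> R) n k F (W : R) : uniq F ->
  (forall i, (i < n)%N -> tree_weight k (grow next i) <= W) ->
  kothe_part rho tree_matrix k F (\sum_(0 <= i < n) x i *: unit_vector (grow next i))
    <= W * rho (map x (iota 0 n)).
Proof.
move=> uF HW; case: n HW => [|n] HW.
  rewrite big_geq// [kothe_val 0](_ : _ = 0)// kothe_part0.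
  by rewrite /= symnorm_nil mulr0.
have W0 : 0 <= W by rewrite (le_trans _ (HW 0%N isT))// ltW// exprn_gt0.
pose P (t : I) := (size (val t) < n.+1)%N && (val t == grow next (size (val t))).
rewrite /kothe_part -(@symnorm_map_filter _ rho _ P); last first.
  by move=> t _ /negbTE Pt; rewrite branch_combinationE -/(P t) Pt mulr0.
apply: (@le_trans _ _ (rho [seq W * x (size (val t)) | t <- F & P t])).
  apply: symnorm_map_le => t; rewrite mem_filter => /andP[Pt _].
  rewrite branch_combinationE -/(P t) Pt !normrM ler_wpM2r//.
  rewrite (gtr0_norm (tree_weight_gt0 _ _)) (ger0_norm W0) /=.
  by have /andP[tn /eqP ->] := Pt; exact: HW.
rewrite symnorm_mapZ ger0_norm// ler_wpM2l//.
rewrite (map_comp x (fun t : I => size (val t))).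
apply: (@symnorm_map_subset _ rho _ _ _ x).
  rewrite map_inj_in_uniq ?filter_uniq// => t u.
  rewrite !mem_filter => /andP[/andP[_ /eqP Ht] _] /andP[/andP[_ /eqP Hu] _] tu.
  by apply/val_inj; rewrite Ht Hu tu.
move=> i /mapP[t]; rewrite mem_filter => /andP[/andP[tn _] _] ->.
by rewrite mem_iota.
Qed.

End tree_matrix.

(** * The tree of attempts at a basis *)

Section basis_tree.
Context (R : realType) (rho : symnorm R) (X : tvsType R) (phi : X -> R).
Context (Phi : complete_fnorm phi).
Context (D : nat -> X) (D_dense : forall x e, 0 < e -> exists l, phi (x - D l) < e).

(** A letter (codes, bound, delay), read at position l of a node.  The codes give
    approximations of precision 2^-l to the vectors of rank at most l.  The
    bound is the constant of the l-th upper estimate if l > 0, and that of the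
    lower estimate if l = 0. *)
Definition entry := (seq nat * nat * nat)%type.
Definition entry_codes (x : entry) := x.1.1.
Definition entry_bound (x : entry) := x.1.2.
Definition entry_delay (x : entry) := x.2.
Definition entry0 : entry := ([::], 0, 0)%N.

(** The vectors themselves are only required to exist: the codes are what passes from a
    node to its extensions, and they force convergence along a branch.
    The upper estimates start at m = 1: the first letter has no
    predecessor that could delay it, hence it is visible at all levels and no
    constant written in it could take it into account. *)
Definition node_ok (t : seq entry) := exists v : nat -> X,
  [/\ forall l i, (l < size t)%N -> (i <= l)%N ->
        phi (v i - D (nth 0%N (entry_codes (nth entry0 t l)) i)) < 2^-1 ^+ l,
      forall m x, (0 < m < size t)%N ->
        rho (map x (iota 0 (size t))) <= (entry_bound (nth entry0 t m)).+1%:R^-1 ->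
        phi (combination v x (size t)) <= m%:R^-1 &
      forall x, phi (combination v x (size t)) < (entry_bound (nth entry0 t 0)).+1%:R^-1 ->
        rho (map x (iota 0 (size t))) <= 1].

Definition basis_tree : set (seq entry) :=
  [set t | forall n, (n <= size t)%N -> node_ok (take n t)].

Lemma basis_tree_prefix s t : basis_tree (s ++ t) -> basis_tree s.
Proof.
move=> st n ns; have := st n; rewrite takel_cat// size_cat; apply.
by rewrite (leq_trans ns)// leq_addr.
Qed.

Lemma basis_tree_nil : basis_tree [::].
Proof.
move=> n _; exists (fun=> 0); split => //=.
- by move=> m x; rewrite ltn0 andbF.
- by move=> x _; rewrite symnorm_nil.
Qed.

Lemma basis_tree_rcons t e : basis_tree t -> node_ok (rcons t e) ->
  basis_tree (rcons t e).
Proof.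
move=> Tt te n; rewrite size_rcons leq_eqVlt ltnS => /predU1P[->|nt].
  by rewrite take_oversize// size_rcons.
by rewrite -cats1 takel_cat//; exact: Tt.
Qed.

Definition truncation (x : nat -> R) n i := if (i < n)%N then x i else 0.

Lemma symnorm_truncation (x : nat -> R) n N : (n <= N)%N ->
  rho (map (truncation x n) (iota 0 N)) = rho (map x (iota 0 n)).
Proof.
move=> nN; rewrite -(@symnorm_map_filter _ rho _ (fun i => i < n)%N); last first.
  by move=> i _ /negbTE h; rewrite /truncation h.
rewrite -[in LHS](subnKC nN) iotaD filter_cat add0n.
rewrite (_ : [seq i <- iota n _ | _] = [::]) ?cats0; last first.
  rewrite -(filter_pred0 (iota n (N - n))); apply: eq_in_filter => i.
  by rewrite mem_iota => /andP[ni _]; rewrite ltnNge ni.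
rewrite (_ : [seq i <- iota 0 n | _] = iota 0 n); last first.
  by apply/all_filterP/allP => i; rewrite mem_iota.
by congr (rho _); apply/eq_in_map => i; rewrite mem_iota /truncation => /andP[_ ->].
Qed.

Lemma combination_truncation (v : nat -> X) (x : nat -> R) n N : (n <= N)%N ->
  combination v (truncation x n) N = combination v x n.
Proof.
move=> nN; rewrite /combination (big_cat_nat (leq0n n) nN)/= [X in _ + X]big1_seq ?addr0.
  apply: eq_big_seq => i; rewrite mem_index_iota => /andP[_ h].
  by rewrite /truncation h.
move=> i /andP[_]; rewrite mem_index_iota => /andP[h _].
by rewrite /truncation ltnNge h scale0r.
Qed.

Lemma combination_cvg (V : nat -> nat -> X) (v : nat -> X) (x : nat -> R) n :
  (forall i, fnorm_cvg phi (V ^~ i) (v i)) ->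
  fnorm_cvg phi (fun N => combination (V N) x n) (combination v x n).
Proof.
move=> Vv; elim: n => [|n IH].
  move=> e e0; exists 0%N => N _.
  by rewrite /combination !big_geq// subrr (fnorm0 Phi).
rewrite /combination (_ : (fun N => _) = fun N => combination (V N) x n + x n *: V N n).
  by rewrite big_nat_recr//=; apply: (fnorm_cvgD Phi) => //; exact: fnorm_cvgZ.
by apply/funext => N; rewrite big_nat_recr.
Qed.

(** The vectors chosen for the successive nodes of a branch may all differ, but the
    common codes make them converge, and the estimates, which concern finitely
    many vectors at a time, pass to the limit. *)
Lemma basis_tree_copy (B : normedModType R) (co : B -> nat -> R) :
  coordinates rho co -> ill_founded basis_tree -> contains_copy X B.
Proof.
move=> Co [s Hs].
have ok n : node_ok (mkseq s n).
  by have := Hs n n; rewrite size_mkseq take_oversize ?size_mkseq//; apply.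
have [V HV] := choice ok.
have VD n l i : (l < n)%N -> (i <= l)%N ->
    phi (V n i - D (nth 0%N (entry_codes (s l)) i)) < 2^-1 ^+ l.
  by move=> ln il; have [+ _ _] := HV n; move=> /(_ l i); rewrite size_mkseq nth_mkseq//; apply.
have Vcauchy i : fnorm_cauchy phi (V ^~ i).
  move=> e e0; have e2 : 0 < e / 2 by lra.
  have [l il le] := half_expr_lt i e2; exists l.+1 => m n lm ln.
  pose d := D (nth 0%N (entry_codes (s l)) i).
  rewrite (le_lt_trans (ler_fnorm_dist Phi d _ _))// (fnorm_distC Phi d).
  by have := VD m l i lm il; have := VD n l i ln il; rewrite -/d; lra.
have [v Hv] := choice (fun i => fnorm_complete Phi (Vcauchy i)).
apply: (contains_copy_basis Co Phi (v := v)).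
  move=> e e0; have [m Hm] := archimedean_inv_lt e0.
  exists (entry_bound (s m.+1)).+1%:R^-1; first by rewrite invr_gt0.
  move=> x n xn; apply: (fnorm_cvg_le Phi (combination_cvg x n Hv)).
  exists (maxn n m.+2) => N; rewrite geq_max => /andP[nN mN].
  have [_ /(_ m.+1 (truncation x n)) + _] := HV N.
  rewrite size_mkseq nth_mkseq// symnorm_truncation// combination_truncation//.
  by move=> h; rewrite (le_trans (h _ _)) ?(ltW (Hm _ (leqnn m))).
exists (entry_bound (s 0%N)).+1%:R^-1; first by rewrite invr_gt0.
move=> x n /(fnorm_cvg_lt Phi (combination_cvg x n Hv))[N HN].
pose M := (maxn n N).+1.
have [_ _ /(_ (truncation x n))] := HV M.
have nM : (n <= M)%N by rewrite /M; lia.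
rewrite size_mkseq nth_mkseq// symnorm_truncation// combination_truncation//.
by apply; apply: HN; rewrite /M; lia.
Qed.

Local Notation matrix := (tree_matrix R entry_delay basis_tree).
Local Notation Y := (kothe rho matrix).
Local Notation unit := (@unit_vector R _ entry_delay basis_tree rho).

(** From an embedding f of the Koethe space of the tree, a node s of length n is
    extended by the letter that describes the images under f of the unit vectors
    on the n + 1 prefixes of s, together with constants that the extension
    satisfies, whatever its later letters. *)
Lemma embedding_ill_founded : contains_copy X Y -> ill_founded basis_tree.
Proof.
move=> [S _ [f [g [fS fK fc gc]]]].
have f_upper (m : nat) : exists Kd : nat * R, 0 < Kd.2 /\ ((0 < m)%N -> forall y : Y,
    (forall k F, (k < Kd.1)%N -> uniq F -> kothe_part rho matrix k F y <= Kd.2) ->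
    phi (f y) <= m%:R^-1).
  case: m => [|m]; first by exists (0%N, 1); split.
  have m0 : 0 < m.+1%:R^-1 :> R by rewrite invr_gt0.
  have : nbhs (f 0) [set z | phi z < m.+1%:R^-1].
    by rewrite linear0; apply/(fnorm_nbhsP Phi); exists m.+1%:R^-1 => // z; rewrite subr0.
  move=> /fc /nbhs_ballP[d /= d0 Hd]; have d2 : 0 < d / 2 by lra.
  have [K HK] := kothe_fnorm_le_finite rho matrix d2.
  exists (K, d / 2); split => // _ y /HK yd; apply/ltW/Hd.
  by rewrite kothe_ballE sub0r kothe_fnormN; lra.
have [Kd HKd] := choice f_upper.
pose K m := (Kd m).1.
(* The constant of the lower estimate is uniform and comes from continuity of the
   inverse at 0. *)
have [c Hc] : exists c : nat, forall y : Y, phi (f y) < c.+1%:R^-1 -> kothe_fnorm y < 1.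
  have : nbhs (g (f 0)) [set y : Y | kothe_fnorm y < 1].
    rewrite fK; apply/nbhs_ballP; exists 1 => //= y.
    by rewrite kothe_ballE sub0r kothe_fnormN.
  have f0S : S (f 0) by rewrite -fS; exists 0.
  move=> /(gc (f 0)); rewrite /nbhs/= /nbhs/= -nbhs_subspace_in// => gS.
  have [e e0 He] := (fnorm_nbhsP Phi (f 0) _).1 gS.
  have [c Hc] := archimedean_inv_lt e0; exists c => y yc.
  rewrite -(fK y); apply: He; first by rewrite linear0 subr0 (lt_trans yc)// Hc.
  by rewrite -fS; exists y.
have code (nx : nat * X) : exists l, phi (nx.2 - D l) < 2^-1 ^+ nx.1.
  by apply: D_dense; rewrite exprn_gt0.
have {code}[code Hcode] := choice code.
(* The n-th upper estimate costs the weights of s at the levels below K n,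
   relative to the radius that continuity of f provides. *)
pose big_bound s := Num.trunc ((\sum_(k < K (size s)) tree_weight R entry_delay k s)
  / (Kd (size s)).2).
pose next (s : seq entry) : entry :=
  ([seq code (size s, f (unit (take i s))) | i <- iota 0 (size s).+1],
   if size s == 0%N then c else big_bound s,
   \max_(m < (size s).+2) K m).
have codesE s : entry_codes (next s) =
    [seq code (size s, f (unit (take i s))) | i <- iota 0 (size s).+1] by [].
have boundE s : entry_bound (next s) = if size s == 0%N then c else big_bound s by [].
have delayE s : entry_delay (next s) = \max_(m < (size s).+2) K m by [].
exists (fun n => next (grow next n)) => n; rewrite -grow_mkseq.
elim: n => [|n IH]; first exact: basis_tree_nil.
apply: basis_tree_rcons => //.
have T_grow i : (i <= n)%N -> basis_tree (grow next i).
  move=> ni; apply: (@basis_tree_prefix _ (drop i (grow next n))).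
  by rewrite -(take_grow next ni) cat_take_drop.
rewrite -/(grow next n.+1).
pose v i := f (unit (grow next i)).
have combE x m : combination v x m = f (\sum_(0 <= i < m) x i *: unit (grow next i)).
  by rewrite linear_sum; apply: eq_bigr => i _; rewrite linearZ.
exists v; rewrite size_grow; split.
- move=> l i ln il; rewrite nth_grow//.
  rewrite codesE (nth_map 0%N) ?size_iota ?size_grow ?ltnS//.
  rewrite nth_iota ?ltnS// add0n take_grow//.
  exact: (Hcode (l, v i)).
- move=> m x /andP[m0 mn]; rewrite nth_grow// boundE size_grow gtn_eqF// => xm.
  rewrite combE; apply: (HKd m).2 => // k F kK uF.
  (* From position m on, the delays hide all letters from the levels below K m. *)
  have visible i : (i < n.+1)%N -> (visible_code entry_delay k 0 (grow next i) <=
      visible_code entry_delay k 0 (grow next m))%N.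
    move=> _; have [im|/ltnW mi] := leqP i m.
      rewrite -(cat_take_drop i (grow next m)) take_grow// visible_code_cat.
      exact: leq_addr.
    suff -> : visible_code entry_delay k 0 (grow next i) =
      visible_code entry_delay k 0 (grow next m) by [].
    rewrite -(subnKC mi); elim: (i - m)%N => [|j IHj]; first by rewrite addn0.
    rewrite addnS /= -cats1 visible_code_cat IHj /= ifN ?addn0//.
    have [i' mjE] : exists i', (m + j = i'.+1)%N by exists (m + j).-1; lia.
    rewrite mjE /= map_rcons last_rcons delayE size_grow -ltnNge.
    have mi' : (m < i'.+2)%N by lia.
    apply: leq_trans kK _.
    exact: (@leq_bigmax _ (fun m : 'I_(i'.+2) => K m) (Ordinal mi')).
  pose W := tree_weight R entry_delay k (grow next m).
  have W0 : 0 < W by rewrite exprn_gt0.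
  apply: (le_trans (@branch_part_le _ _ _ _ _ next x n.+1 k F W uF _)).
    by move=> i /visible h; rewrite ler_weXn2l ?ler1n// leq_mul2l h orbT.
  apply: (le_trans (ler_wpM2l (ltW W0) xm)).
  have [d0 _] := HKd m.
  rewrite ler_pdivrMr// mulrC -ler_pdivrMr//.
  apply: le_trans (ltW (truncnS_gt _)).
  rewrite size_grow ler_wpM2r ?invr_ge0 ?(ltW d0)//.
  rewrite (bigD1 (Ordinal kK))//= -/W lerDl sumr_ge0// => i _.
  by rewrite exprn_ge0.
- move=> x; rewrite nth_grow// boundE /= combE => /Hc y1.
  pose F : seq {t : seq entry | `[< basis_tree t >]} :=
    pmap insub [seq grow next i | i <- iota 0 n.+1].
  have uF : uniq F.
    apply: pmap_sub_uniq; rewrite map_inj_uniq ?iota_uniq// => i i' /(congr1 size).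
    by rewrite !size_grow.
  have FE : [seq val t | t <- F] = [seq grow next i | i <- iota 0 n.+1].
    rewrite /F (pmap_filter (@insubK _ _ _)); apply/all_filterP/allP => _ /mapP[i + ->].
    rewrite mem_iota add0n ltnS isSome_insub => /andP[_ /T_grow h]; exact/asboolP.
  (* All weights of level 0 are 1. *)
  have := @kothe_fnorm_part _ _ rho matrix _ 0%N F uF.
  rewrite invr1 => /(_ _ y1) h; apply: le_trans (ltW y1); apply: le_trans h.
  rewrite /kothe_part.
  rewrite (_ : [seq _ | t <- F] = [seq truncation x n.+1 i | i <- [seq size (val t) | t <- F]]).
    rewrite (_ : [seq size (val t) | t <- F] = iota 0 n.+1) ?symnorm_truncation//.
    rewrite (map_comp size) FE -map_comp -[RHS]map_id; apply: eq_map => i /=.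
    by rewrite size_grow.
  rewrite -map_comp; apply/eq_in_map => t tF /=.
  rewrite branch_combinationE /tree_weight mul0n expr0 mul1r /truncation.
  have : val t \in [seq grow next i | i <- iota 0 n.+1] by rewrite -FE map_f.
  move=> /mapP[i _ ti]; rewrite -[sval t]/(val t) ti.
  by rewrite size_grow eqxx andbT.
Qed.

End basis_tree.

Lemma separable_dense_seq (R : realType) (X : tvsType R) (phi : X -> R) :
  complete_fnorm phi -> separable X ->
  exists D : nat -> X, forall x e, 0 < e -> exists l, phi (x - D l) < e.
Proof.
move=> Phi [A /countable_injP[c c_inj] A_dense].
have inv (l : nat) : exists x : X, forall y, A y -> c y = l -> y = x.
  have [[y [Ay cy]] | none] := pselect (exists y, A y /\ c y = l); last first.
    by exists 0 => y Ay cy; exfalso; apply: none; exists y.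
  by exists y => z Az cz; apply: c_inj; rewrite ?inE// cy.
have [D HD] := choice inv; exists D => x e e0.
have bx : nbhs x [set y | phi (y - x) < e] by apply/(fnorm_nbhsP Phi); exists e.
move: bx; rewrite nbhsE => -[U [Uo Ux] Ue].
have [|y [Uy Ay]] := A_dense U _ Uo; first by exists x.
by exists (c y); rewrite -(HD _ _ Ay erefl) (fnorm_distC Phi); exact: Ue.
Qed.

(** If the tree were well founded, its Koethe space would be a separable Montel
    space, hence embed in X, and the embedding would produce an infinite branch. *)
Lemma universal_contains_coordinates (R : realType) (X : tvsType R)
    (rho : symnorm R) (B : normedModType R) (co : B -> nat -> R) :
  coordinates rho co -> frechet X -> separable X ->
  (forall Y : tvsType R, montel Y -> separable Y -> contains_copy X Y) ->
  contains_copy X B.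
Proof.
move=> Co /frechet_complete_fnorm[phi Phi] sepX univ.
have [D D_dense] := separable_dense_seq Phi sepX.
apply: (basis_tree_copy Phi (D := D) Co).
apply: contrapT => wf; apply: (wf).
have am := @tree_matrix_montel R _ entry_delay _
  (@basis_tree_prefix _ rho _ phi D) entry0 wf.
apply: (embedding_ill_founded Phi D_dense); apply: univ.
  exact: kothe_montel.
exact: kothe_separable.
Qed.

Theorem corollary4p36 (R : realType) (X : tvsType R)
  (frechetX : frechet X) (separableX : separable X)
  (montelX : forall Y : tvsType R, montel Y -> separable Y ->
    contains_copy X Y) :
  contains_copy X (c0 R) /\
  forall (p : R) (p1 : 1 <= p), contains_copy X (ellp p1).
Proof.
split=> [|p p1].
  exact: (universal_contains_coordinates (@c0_coordinates R)).
exact: (universal_contains_coordinates (ellp_coordinates p1)).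
Qed.
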